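(* Let $K$ be a field with $\mathrm{char}\,K\neq 2$ and let $\mathbb{G}$ be an algebraic supergroup over $K$. Let $\rho : \mathbb{G}_{ev} \to \mathsf{GL}(V)$ denote the linear representation associated with the right $\mathbb{G}_{ev}$-module $V= \mathrm{Lie}(\mathbb{G})_1$. Then $$\mathcal{Z}(\mathbb{G})_{ev} = \mathcal{Z}(\mathbb{G}_{ev})\cap \mathrm{Ker}\, \rho .$$
   Context: ''Super'' means $\mathbb{Z}_2$-graded. $\mathsf{SAlg}_K$ is the category of super-commutative superalgebras over $K$. An affine supergroup $\mathbb{G}$ is a representable group-valued functor on $\mathsf{SAlg}_K$, represented by a super-commutative Hopf superalgebra $K[\mathbb{G}]$; it is an algebraic supergroup if $K[\mathbb{G}]$ is finitely generated. $\mathbb{G}_{ev}$ is the affine group (scheme) represented by $K[\mathbb{G}]/(K[\mathbb{G}]_1)$, where $(K[\mathbb{G}]_1)$ is the ideal generated by the odd component; regarded as $R\mapsto \mathbb{G}(R_0)$ it is a closed super-subgroup of $\mathbb{G}$. The center $\mathcal{Z}(\mathbb{G})$ is the group-valued functor such that $\mathcal{Z}(\mathbb{G})(R)$ consists of the elements of $\mathbb{G}(R)$ whose image in $\mathbb{G}(S)$ is central for every morphism $R\to S$ in $\mathsf{SAlg}_K$; it is known to be a closed super-subgroup of $\mathbb{G}$. (For an affine group the center is defined likewise, using commutative algebras.) $\mathrm{Lie}(\mathbb{G})$ is the Lie superalgebra of $\mathbb{G}$, with canonical pairing $\langle\ ,\ \rangle:\mathrm{Lie}(\mathbb{G})\times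 K[\mathbb{G}]\to K$. The right $\mathbb{G}_{ev}$-module structure on the odd component $V=\mathrm{Lie}(\mathbb{G})_1$ is determined by $\langle v^{\gamma}, a \rangle = \gamma^{-1}(\overline{a}_{(1)}) \langle v, a_{(2)}\rangle \gamma(\overline{a}_{(3)})$ for $v\in V$, $\gamma\in \mathbb{G}_{ev}(R)$ ($R$ a commutative algebra), $a\in K[\mathbb{G}]$, where $a\mapsto\overline{a}$ is the quotient map $K[\mathbb{G}]\to K[\mathbb{G}_{ev}]$ and Sweedler notation is used. *)

(* Defs.v *)
From HB Require Import structures.
From mathcomp Require Import all_boot all_order all_algebra.
From mathcomp Require Import boolp classical_sets.

Set Implicit Arguments.
Unset Strict Implicit.
Unset Printing Implicit Defensive.

Import GRing.Theory.
Local Open Scope ring_scope.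
Local Open Scope quotient_scope.

Definition bilin (K : fieldType) (A B V : lmodType K) (f : A -> B -> V) : Prop :=
  (forall b, linear (f^~ b)) /\ (forall a, linear (f a)).

Section Tensor.
Variables (K : fieldType) (A B : lmodType K).

(* A formal sum of pairs stands for the tensor it denotes; two of them are
   identified when no bilinear map separates them. *)
Definition tsum (V : lmodType K) (f : A -> B -> V) (s : seq (A * B)) : V :=
  \sum_(p <- s) f p.1 p.2.

Definition tequiv : rel (seq (A * B)) := fun s t =>
  `[< forall (V : lmodType K) (f : A -> B -> V), bilin f -> tsum f s = tsum f t >].

Lemma tequiv_refl : reflexive tequiv.
Proof. by move=> s; apply/asboolP. Qed.

Lemma tequiv_sym : symmetric tequiv.
Proof.
by move=> s t; apply/asboolP/asboolP => h V f bf; rewrite (h V f bf).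
Qed.

Lemma tequiv_trans : transitive tequiv.
Proof.
move=> t s u /asboolP h1 /asboolP h2; apply/asboolP => V f bf.
by rewrite (h1 V f bf) (h2 V f bf).
Qed.

Canonical tequiv_rel := EquivRel tequiv tequiv_refl tequiv_sym tequiv_trans.

Definition tensor := {eq_quot tequiv_rel}.
HB.instance Definition _ := Choice.on tensor.

Definition tclass (s : seq (A * B)) : tensor := \pi_tensor s.

Definition tpure (a : A) (b : B) : tensor := tclass [:: (a, b)].

(* The linear map A (x) B -> V induced by f; meaningful when f is bilinear. *)
Definition tlift (V : lmodType K) (f : A -> B -> V) (t : tensor) : V :=
  tsum f (repr t).

Lemma tlift_class (V : lmodType K) (f : A -> B -> V) s :
  bilin f -> tlift f (tclass s) = tsum f s.
Proof.
move=> bf; have /eqmodP /= /asboolP h : repr (tclass s) = s %[mod tensor].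
  by rewrite reprK.
exact: h.
Qed.

Lemma tensor_ext (x y : tensor) :
  (forall (V : lmodType K) (f : A -> B -> V), bilin f -> tlift f x = tlift f y) ->
  x = y.
Proof.
by move=> h; rewrite -[x]reprK -[y]reprK; apply/eqmodP/asboolP.
Qed.

Definition tadd (x y : tensor) : tensor := tclass (repr x ++ repr y).
Definition tscale (k : K) (x : tensor) : tensor :=
  tclass [seq (k *: p.1, p.2) | p <- repr x].
Definition topp (x : tensor) : tensor := tscale (-1) x.

Lemma bilinZl (V : lmodType K) (f : A -> B -> V) k a b :
  bilin f -> f (k *: a) b = k *: f a b.
Proof. by case=> h _; rewrite -(scalable_linear (h b)). Qed.

Lemma bilinZr (V : lmodType K) (f : A -> B -> V) k a b :
  bilin f -> f a (k *: b) = k *: f a b.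
Proof. by case=> _ h; rewrite -(scalable_linear (h a)). Qed.

Lemma bilinDl (V : lmodType K) (f : A -> B -> V) a a' b :
  bilin f -> f (a + a') b = f a b + f a' b.
Proof. by case=> h _; have := h b 1 a a'; rewrite /= !scale1r. Qed.

Lemma bilinDr (V : lmodType K) (f : A -> B -> V) a b b' :
  bilin f -> f a (b + b') = f a b + f a b'.
Proof. by case=> _ h; have := h a 1 b b'; rewrite /= !scale1r. Qed.

Lemma tlift_add (V : lmodType K) (f : A -> B -> V) x y :
  bilin f -> tlift f (tadd x y) = tlift f x + tlift f y.
Proof. by move=> bf; rewrite tlift_class // /tsum big_cat. Qed.

Lemma tlift_scale (V : lmodType K) (f : A -> B -> V) k x :
  bilin f -> tlift f (tscale k x) = k *: tlift f x.
Proof.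
move=> bf; rewrite tlift_class // /tsum big_map scaler_sumr.
by apply: eq_bigr => p _; rewrite bilinZl.
Qed.

Lemma tlift_zero (V : lmodType K) (f : A -> B -> V) :
  bilin f -> tlift f (tclass [::]) = 0.
Proof. by move=> bf; rewrite tlift_class // /tsum big_nil. Qed.

Lemma taddA : associative tadd.
Proof.
by move=> x y z; apply: tensor_ext => V f bf; rewrite !tlift_add // addrA.
Qed.

Lemma taddC : commutative tadd.
Proof.
by move=> x y; apply: tensor_ext => V f bf; rewrite !tlift_add // addrC.
Qed.

Lemma tadd0 : left_id (tclass [::]) tadd.
Proof.
by move=> x; apply: tensor_ext => V f bf; rewrite tlift_add // tlift_zero // add0r.
Qed.

Lemma taddN : left_inverse (tclass [::]) topp tadd.
Proof.
move=> x; apply: tensor_ext => V f bf.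
by rewrite tlift_add // tlift_zero // tlift_scale // scaleN1r addNr.
Qed.

HB.instance Definition _ :=
  GRing.isZmodule.Build tensor taddA taddC tadd0 taddN.

Lemma tscaleA k l x : tscale k (tscale l x) = tscale (k * l) x.
Proof. by apply: tensor_ext => V f bf; rewrite !tlift_scale // scalerA. Qed.

Lemma tscale1 : left_id 1 tscale.
Proof. by move=> x; apply: tensor_ext => V f bf; rewrite tlift_scale // scale1r. Qed.

Lemma tscaleDr : right_distributive tscale +%R.
Proof.
move=> k x y; apply: tensor_ext => V f bf.
by rewrite tlift_scale // !tlift_add // !tlift_scale // scalerDr.
Qed.

Lemma tscaleDl x : {morph tscale^~ x : k l / k + l}.
Proof.
move=> k l; apply: tensor_ext => V f bf.
by rewrite tlift_add // !tlift_scale // scalerDl.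
Qed.

HB.instance Definition _ :=
  GRing.Zmodule_isLmodule.Build K tensor tscaleA tscale1 tscaleDr tscaleDl.

Lemma tlift_pure (V : lmodType K) (f : A -> B -> V) a b :
  bilin f -> tlift f (tpure a b) = f a b.
Proof. by move=> bf; rewrite tlift_class // /tsum big_seq1. Qed.

Lemma tlift_linear (V : lmodType K) (f : A -> B -> V) :
  bilin f -> linear (tlift f).
Proof. by move=> bf k x y; rewrite tlift_add // tlift_scale. Qed.

Lemma tpure_bilin : bilin tpure.
Proof.
split=> c k a b; apply: tensor_ext => V f bf;
  rewrite (tlift_linear bf) !tlift_pure //.
- by rewrite bilinDl // bilinZl.
- by rewrite bilinDr // bilinZr.
Qed.

Lemma tensor_ind (P : tensor -> Prop) :
  P 0 -> (forall a b, P (tpure a b)) -> (forall x y, P x -> P y -> P (x + y)) ->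
  forall x, P x.
Proof.
move=> P0 Pp PD x.
have -> : x = \sum_(p <- repr x) tpure p.1 p.2.
  apply: tensor_ext => V f bf.
  pose F : {linear tensor -> V} :=
    HB.pack (tlift f) (GRing.isLinear.Build K tensor V *:%R (tlift f) (tlift_linear bf)).
  rewrite -[tlift f (\sum_(p <- _) _)]/(F _) linear_sum /=.
  by apply: eq_bigr => p _; rewrite tlift_pure.
elim: (repr x) => [|p s IH]; first by rewrite big_nil.
by rewrite big_cons; apply: PD.
Qed.

Lemma linear_tensor_ext (V : lmodType K) (f g : tensor -> V) :
  linear f -> linear g -> (forall a b, f (tpure a b) = g (tpure a b)) -> f =1 g.
Proof.
move=> lf lg fg; have z (h : tensor -> V) : linear h -> h 0 = 0.
  by move=> lh; have := lh (-1) 0 0; rewrite scaler0 addr0 scaleN1r addNr.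
have d (h : tensor -> V) x y : linear h -> h (x + y) = h x + h y.
  by move=> lh; have := lh 1 x y; rewrite !scale1r.
by apply: tensor_ind => [|//|x y hx hy]; rewrite ?z // !d // hx hy.
Qed.

End Tensor.

Arguments tpure {K A B}.

(* An associative unital K-algebra with a Z/2-grading A = A_0 (+) A_1 given by
   its two projections ([false] is the even degree).  MathComp's [algType] is
   not used because it excludes the zero algebra. *)
Record superAlg (K : fieldType) := SuperAlg {
  sa_lmod : lmodType K;
  sa_one : sa_lmod;
  sa_mul : sa_lmod -> sa_lmod -> sa_lmod;
  sa_hpart : bool -> sa_lmod -> sa_lmod;
  sa_mulA : associative sa_mul;
  sa_mul1l : left_id sa_one sa_mul;
  sa_mul1r : right_id sa_one sa_mul;
  sa_mul_bilin : bilin sa_mul;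
  sa_hpart_linear : forall i, linear (sa_hpart i);
  sa_hpart_sum : forall a, sa_hpart false a + sa_hpart true a = a;
  sa_hpart_proj : forall i j a,
    sa_hpart i (sa_hpart j a) = if i == j then sa_hpart j a else 0;
  sa_hpart_one : sa_hpart false sa_one = sa_one;
  sa_hpart_mul : forall i j a b,
    sa_hpart (i (+) j) (sa_mul (sa_hpart i a) (sa_hpart j b)) =
    sa_mul (sa_hpart i a) (sa_hpart j b)
}.

Definition sa_sort (K : fieldType) (A : superAlg K) : Type := sa_lmod A.
Coercion sa_sort : superAlg >-> Sortclass.

Section SuperAlgTheory.
Variables (K : fieldType) (A : superAlg K).

HB.instance Definition _ := GRing.Lmodule.on (sa_sort A).

Lemma sa_mulDl : left_distributive (@sa_mul K A) +%R.
Proof. by move=> a b c; rewrite bilinDl //; apply: sa_mul_bilin. Qed.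

Lemma sa_mulDr : right_distributive (@sa_mul K A) +%R.
Proof. by move=> a b c; rewrite bilinDr //; apply: sa_mul_bilin. Qed.

HB.instance Definition _ := GRing.Zmodule_isPzRing.Build (sa_sort A)
  (@sa_mulA K A) (@sa_mul1l K A) (@sa_mul1r K A) sa_mulDl sa_mulDr.

Definition hpart (i : bool) (a : A) : A := sa_hpart i a.

Lemma sscalerAl (k : K) (a b : A) : k *: (a * b) = (k *: a) * b.
Proof. by symmetry; apply: (bilinZl _ _ _ (sa_mul_bilin A)). Qed.

Lemma sscalerAr (k : K) (a b : A) : k *: (a * b) = a * (k *: b).
Proof. by symmetry; apply: (bilinZr _ _ _ (sa_mul_bilin A)). Qed.

Lemma hpart_linear i : linear (hpart i).
Proof. exact: sa_hpart_linear. Qed.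

HB.instance Definition _ i :=
  GRing.isLinear.Build K A A *:%R (hpart i) (hpart_linear i).

Lemma hpart_sum (a : A) : hpart false a + hpart true a = a.
Proof. exact: sa_hpart_sum. Qed.

Lemma hpart_proj i j (a : A) :
  hpart i (hpart j a) = if i == j then hpart j a else 0.
Proof. exact: sa_hpart_proj. Qed.

Lemma hpart_one : hpart false 1 = 1.
Proof. exact: sa_hpart_one. Qed.

Lemma hpart_mul i j (a b : A) :
  hpart (i (+) j) (hpart i a * hpart j b) = hpart i a * hpart j b.
Proof. exact: sa_hpart_mul. Qed.

End SuperAlgTheory.

Definition super_commutative (K : fieldType) (A : superAlg K) : Prop :=
  forall i j (a b : A),
    hpart i a * hpart j b = (-1) ^+ (i && j) *: (hpart j b * hpart i a).

(* The objects of SAlg_K. *)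
Record superComAlg (K : fieldType) := SuperComAlg {
  sca_superAlg :> superAlg K;
  super_mulC : super_commutative sca_superAlg
}.

(* Commutative algebras are regarded as purely even superalgebras. *)
Definition purely_even (K : fieldType) (A : superAlg K) : Prop :=
  forall a : A, hpart true a = 0.

(* The morphisms of SAlg_K. *)
Definition is_superhom (K : fieldType) (A B : superAlg K) (f : A -> B) : Prop :=
  [/\ linear f, f 1 = 1, {morph f : a b / a * b} &
      forall i, {morph f : a / hpart i a}].

Record superhom (K : fieldType) (A B : superAlg K) := SuperHom {
  superhom_fun :> A -> B;
  superhomP : is_superhom superhom_fun
}.

Lemma superhom_eq (K : fieldType) (A B : superAlg K) (f g : superhom A B) :
  f =1 g -> f = g.
Proof.
case: f g => [f fP] [g gP] /= /funext fg; subst g.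
by congr SuperHom; apply: Prop_irrelevance.
Qed.

Lemma superhom_comp_subproof (K : fieldType) (A B C : superAlg K)
  (g : superhom B C) (f : superhom A B) : is_superhom (g \o f).
Proof.
case: g f => [g [gl g1 gm gp]] [f [fl f1 fm fp]]; split => /=.
- by move=> k a b /=; rewrite fl gl.
- by rewrite f1 g1.
- by move=> a b /=; rewrite fm gm.
- by move=> i a /=; rewrite fp gp.
Qed.

Definition superhom_comp (K : fieldType) (A B C : superAlg K)
  (g : superhom B C) (f : superhom A B) : superhom A C :=
  SuperHom (superhom_comp_subproof g f).

Section Ground.
Variable K : fieldType.

Definition ground_hpart (i : bool) (a : K^o) : K^o := if i then 0 else a.

Lemma ground_mul_bilin : bilin (fun a b : K^o => a * b : K^o).
Proof.
split=> c k a b /=; first by rewrite mulrDl scalerAl.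
by rewrite mulrDr scalerAr.
Qed.

Lemma ground_hpart_linear i : linear (ground_hpart i).
Proof. by case: i => k a b //=; rewrite scaler0 addr0. Qed.

Lemma ground_hpart_sum a : ground_hpart false a + ground_hpart true a = a.
Proof. by rewrite /= addr0. Qed.

Lemma ground_hpart_proj i j a :
  ground_hpart i (ground_hpart j a) = if i == j then ground_hpart j a else 0.
Proof. by case: i j => [] []. Qed.

Lemma ground_hpart_mul i j a b :
  ground_hpart (i (+) j) (ground_hpart i a * ground_hpart j b) =
  ground_hpart i a * ground_hpart j b.
Proof. by case: i j => [] [] //=; rewrite ?mul0r ?mulr0. Qed.

Definition ground : superAlg K :=
  @SuperAlg K K^o 1 *%R ground_hpart (@mulrA K) (@mul1r K) (@mulr1 K)
    ground_mul_bilin ground_hpart_linear ground_hpart_sum ground_hpart_proj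
    (erefl _) ground_hpart_mul.

End Ground.

Section TensorSuperAlg.
Variables (K : fieldType) (A B : superAlg K).
Local Notation T := (tensor A B).

Definition tmul_pure (a : A) (b : B) (c : A) (d : B) : T :=
  \sum_(i : bool) \sum_(j : bool)
    (-1) ^+ (i && j) *: tpure (a * hpart j c) (hpart i b * d).

(* (a (x) b) (c (x) d) = (-1)^(|b||c|) ac (x) bd for homogeneous b and c *)
Definition tmul (x y : T) : T :=
  tlift (fun a b => tlift (fun c d => tmul_pure a b c d) y) x.

Definition thpart (k : bool) (x : T) : T :=
  tlift (fun a b => \sum_(i : bool) tpure (hpart i a) (hpart (i (+) k) b) : T) x.

Lemma tpureDl (a a' : A) (b : B) : tpure (a + a') b = tpure a b + tpure a' b :> T.
Proof. by rewrite (bilinDl _ _ _ (tpure_bilin A B)). Qed.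
Lemma tpureDr (a : A) (b b' : B) : tpure a (b + b') = tpure a b + tpure a b' :> T.
Proof. by rewrite (bilinDr _ _ _ (tpure_bilin A B)). Qed.
Lemma tpureZl k (a : A) (b : B) : tpure (k *: a) b = k *: tpure a b :> T.
Proof. by rewrite (bilinZl _ _ _ (tpure_bilin A B)). Qed.
Lemma tpureZr k (a : A) (b : B) : tpure a (k *: b) = k *: tpure a b :> T.
Proof. by rewrite (bilinZr _ _ _ (tpure_bilin A B)). Qed.
Lemma tpure0l (b : B) : tpure 0 b = 0 :> T.
Proof. by rewrite -(scale0r 0) tpureZl scale0r. Qed.
Lemma tpure0r (a : A) : tpure a 0 = 0 :> T.
Proof. by rewrite -(scale0r 0) tpureZr scale0r. Qed.

Lemma tmul_pure_bilinr (a : A) (b : B) : bilin (tmul_pure a b).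
Proof.
split=> [d | c] k u v; rewrite /tmul_pure /= scaler_sumr -big_split /=;
  apply: eq_bigr => i _; rewrite scaler_sumr -big_split /=;
  apply: eq_bigr => j _; rewrite scalerA [k * _]mulrC -scalerA -scalerDr; congr (_ *: _).
- by rewrite linearP /= mulrDr -sscalerAr tpureDl tpureZl.
- by rewrite mulrDr -sscalerAr tpureDr tpureZr.
Qed.

Lemma tmul_pure_linear1 (b : B) (c : A) (d : B) : linear (fun a => tmul_pure a b c d).
Proof.
move=> k u v; rewrite /tmul_pure /= scaler_sumr -big_split /=;
  apply: eq_bigr => i _; rewrite scaler_sumr -big_split /=;
  apply: eq_bigr => j _; rewrite scalerA [k * _]mulrC -scalerA -scalerDr; congr (_ *: _).
by rewrite mulrDl -sscalerAl tpureDl tpureZl.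
Qed.

Lemma tmul_pure_linear2 (a : A) (c : A) (d : B) : linear (fun b => tmul_pure a b c d).
Proof.
move=> k u v; rewrite /tmul_pure /= scaler_sumr -big_split /=;
  apply: eq_bigr => i _; rewrite scaler_sumr -big_split /=;
  apply: eq_bigr => j _; rewrite scalerA [k * _]mulrC -scalerA -scalerDr; congr (_ *: _).
by rewrite linearP /= mulrDl -sscalerAl tpureDr tpureZr.
Qed.

Lemma tmul_pure_bilinl (y : T) :
  bilin (fun (a : A) (b : B) => tlift (fun c d => tmul_pure a b c d) y).
Proof.
split=> [b | a] k u v; move: y.
- apply: linear_tensor_ext => [|l x y|c d].
  + exact/tlift_linear/tmul_pure_bilinr.
  + rewrite !(tlift_linear (tmul_pure_bilinr _ _)) !scalerDr !scalerA [k * l]mulrC.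
    by rewrite addrACA.
  + rewrite !(tlift_pure _ _ (tmul_pure_bilinr _ _)).
    exact: tmul_pure_linear1.
- apply: linear_tensor_ext => [|l x y|c d].
  + exact/tlift_linear/tmul_pure_bilinr.
  + rewrite !(tlift_linear (tmul_pure_bilinr _ _)) !scalerDr !scalerA [k * l]mulrC.
    by rewrite addrACA.
  + rewrite !(tlift_pure _ _ (tmul_pure_bilinr _ _)).
    exact: tmul_pure_linear2.
Qed.

Lemma tmul_bilin : bilin tmul.
Proof.
split=> [y | x]; first exact/tlift_linear/tmul_pure_bilinl.
move=> k u v; move: x; apply: linear_tensor_ext => [|l x y|a b].
- exact/tlift_linear/tmul_pure_bilinl.
- rewrite /tmul !(tlift_linear (tmul_pure_bilinl _)) !scalerDr !scalerA [k * l]mulrC.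
  by rewrite addrACA.
- rewrite /tmul !(tlift_pure _ _ (tmul_pure_bilinl _)).
  exact: (tlift_linear (tmul_pure_bilinr _ _)).
Qed.

Lemma tmulE (a c : A) (b d : B) : tmul (tpure a b) (tpure c d) = tmul_pure a b c d.
Proof.
by rewrite /tmul (tlift_pure _ _ (tmul_pure_bilinl _)) (tlift_pure _ _ (tmul_pure_bilinr _ _)).
Qed.

Lemma tmul_homog i j (a c : A) (b d : B) :
  tmul (tpure a (hpart i b)) (tpure (hpart j c) d) =
  (-1) ^+ (i && j) *: tpure (a * hpart j c) (hpart i b * d).
Proof.
rewrite tmulE /tmul_pure (bigD1 i) //= [X in _ + X]big1 => [|i' ne]; last first.
  by apply: big1 => j' _; rewrite [hpart i' _]hpart_proj (negPf ne) mul0r tpure0r scaler0.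
rewrite addr0 (bigD1 j) //= [X in _ + X]big1 => [|j' ne]; last first.
  by rewrite [hpart j' _]hpart_proj (negPf ne) mulr0 tpure0l scaler0.
by rewrite addr0 !hpart_proj !eqxx.
Qed.

Lemma tensor_homog_ind (P : T -> Prop) :
  P 0 -> (forall i j a b, P (tpure (hpart i a) (hpart j b))) ->
  (forall x y, P x -> P y -> P (x + y)) -> forall x, P x.
Proof.
move=> P0 Pp PD; apply: tensor_ind => // a b.
rewrite -(hpart_sum a) -(hpart_sum b) tpureDl !tpureDr.
by apply: (PD); apply: (PD); apply: Pp.
Qed.

Lemma tmulDl x y z : tmul (x + y) z = tmul x z + tmul y z.
Proof. by rewrite bilinDl //; exact: tmul_bilin. Qed.
Lemma tmulDr x y z : tmul x (y + z) = tmul x y + tmul x z.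
Proof. by rewrite bilinDr //; exact: tmul_bilin. Qed.
Lemma tmulZl k x y : tmul (k *: x) y = k *: tmul x y.
Proof. by rewrite bilinZl //; exact: tmul_bilin. Qed.
Lemma tmulZr k x y : tmul x (k *: y) = k *: tmul x y.
Proof. by rewrite bilinZr //; exact: tmul_bilin. Qed.
Lemma tmul0l x : tmul 0 x = 0.
Proof. by have := tmulZl 0 0 x; rewrite !scale0r. Qed.
Lemma tmul0r x : tmul x 0 = 0.
Proof. by have := tmulZr 0 x 0; rewrite !scale0r. Qed.

Lemma tmulA : associative tmul.
Proof.
move=> x y z; move: x.
apply: tensor_homog_ind => [|i j a b|x x' h h']; first by rewrite !tmul0l.
  2: by rewrite !tmulDl h h'.
move: y; apply: tensor_homog_ind => [|k l c d|y y' h h'].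
  by rewrite tmul0l tmul0r tmul0l.
  2: by rewrite tmulDl !tmulDr tmulDl h h'.
move: z; apply: tensor_homog_ind => [|m n e f|z z' h h'].
  by rewrite !tmul0r.
  2: by rewrite !tmulDr h h'.
rewrite !tmul_homog tmulZl tmulZr -[hpart k c * _]hpart_mul -[hpart j b * _]hpart_mul.
rewrite !tmul_homog !hpart_mul !scalerA !mulrA; congr (_ *: _).
by case: j k l m => [] [] [] []; rewrite /= ?expr0 ?expr1 ?mulrNN ?mulr1 ?mul1r.
Qed.

Definition tone : T := tpure (1 : A) (1 : B).

Lemma tmul1l : left_id tone tmul.
Proof.
move=> x; rewrite /tone; move: x; apply: tensor_homog_ind => [|i j a b|x y h h'].
- by rewrite tmul0r.
- by rewrite -(hpart_one B) tmul_homog /= expr0 scale1r hpart_one !mul1r.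
- by rewrite tmulDr h h'.
Qed.

Lemma tmul1r : right_id tone tmul.
Proof.
move=> x; rewrite /tone; move: x; apply: tensor_homog_ind => [|i j a b|x y h h'].
- by rewrite tmul0l.
- by rewrite -(hpart_one A) tmul_homog andbF expr0 scale1r hpart_one !mulr1.
- by rewrite tmulDl h h'.
Qed.

Lemma thpart_bilin (k : bool) : bilin (fun (a : A) (b : B) =>
  \sum_(i : bool) tpure (hpart i a) (hpart (i (+) k) b) : T).
Proof.
split=> [b | a] l u v; rewrite /= scaler_sumr -big_split /=; apply: eq_bigr => i _.
- by rewrite linearP tpureDl tpureZl.
- by rewrite linearP tpureDr tpureZr.
Qed.

Lemma thpart_linear k : linear (thpart k).
Proof. exact/tlift_linear/thpart_bilin. Qed.

Lemma thpart_homog k i j (a : A) (b : B) :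
  thpart k (tpure (hpart i a) (hpart j b)) =
  if k == i (+) j then tpure (hpart i a) (hpart j b) else 0.
Proof.
rewrite /thpart (tlift_pure _ _ (thpart_bilin k)) (bigD1 i) //= big1 => [|i' ne]; last first.
  by rewrite hpart_proj (negPf ne) tpure0l.
rewrite addr0 !hpart_proj eqxx.
by case: i j k => [] [] []; rewrite //= tpure0r.
Qed.

Lemma thpartD k x y : thpart k (x + y) = thpart k x + thpart k y.
Proof. by have := thpart_linear k 1 x y; rewrite !scale1r. Qed.

Lemma thpart0 k : thpart k 0 = 0.
Proof. by have := thpart_linear k (-1) 0 0; rewrite scaler0 addr0 scaleN1r addNr. Qed.

Lemma thpart_sum x : thpart false x + thpart true x = x.
Proof.
move: x; apply: tensor_homog_ind => [|i j a b|x y h h'].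
- by rewrite !thpart0 addr0.
- by rewrite !thpart_homog; case: i j => [] []; rewrite /= ?addr0 ?add0r.
- by rewrite !thpartD addrACA h h'.
Qed.

Lemma thpart_proj i j x :
  thpart i (thpart j x) = if i == j then thpart j x else 0.
Proof.
move: x; apply: tensor_homog_ind => [|k l a b|x y h h'].
- by rewrite !thpart0 if_same.
- rewrite thpart_homog; case: eqP => [->|_]; last by rewrite thpart0 if_same.
  by rewrite thpart_homog.
- by rewrite !thpartD h h'; case: eqP => _; rewrite ?addr0.
Qed.

Lemma thpart_one : thpart false tone = tone.
Proof.
by rewrite /tone -(hpart_one A) -(hpart_one B) thpart_homog.
Qed.

Lemma thpart_mul i j x y :
  thpart (i (+) j) (tmul (thpart i x) (thpart j y)) = tmul (thpart i x) (thpart j y).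
Proof.
move: x; apply: tensor_homog_ind => [|k l a b|x x' h h'].
- by rewrite thpart0 tmul0l thpart0.
- rewrite thpart_homog; case: eqP => [->|_]; last by rewrite tmul0l thpart0.
  move: y; apply: tensor_homog_ind => [|m n c d|y y' h h'].
  + by rewrite thpart0 tmul0r thpart0.
  + rewrite thpart_homog; case: eqP => [->|_]; last by rewrite tmul0r thpart0.
    rewrite tmul_homog (scalable_linear (thpart_linear _)); congr (_ *: _).
    rewrite -[hpart k a * _]hpart_mul -[hpart l b * _]hpart_mul thpart_homog.
    by case: k l m n => [] [] [] [].
  + by rewrite !thpartD tmulDr thpartD h h'.
- by rewrite !thpartD tmulDl thpartD h h'.
Qed.

Definition tensorSuperAlg : superAlg K :=
  @SuperAlg K T tone tmul thpart tmulA tmul1l tmul1r tmul_bilin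
    thpart_linear thpart_sum thpart_proj thpart_one thpart_mul.

End TensorSuperAlg.

Section TensorLift.
Variables (K : fieldType) (A B : superAlg K).

Lemma superhom_mul_bilin (R : superAlg K) (f : A -> R) (g : B -> R) :
  linear f -> linear g -> bilin (fun a b => f a * g b).
Proof.
move=> fl gl; split=> c k a b /=; first by rewrite fl mulrDl sscalerAl.
by rewrite gl mulrDr sscalerAr.
Qed.

(* f (x) g : A (x) B -> R; multiplicative because R is super-commutative. *)
Lemma tlift_superhom_subproof (R : superComAlg K) (f : superhom A R) (g : superhom B R) :
  @is_superhom K (tensorSuperAlg A B) R (tlift (fun a b => f a * g b)).
Proof.
case: f g => [f [fl f1 fm fp]] [g [gl g1 gm gp]] /=.
have bfg := superhom_mul_bilin fl gl.
set F := tlift _.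
have Fl : linear F by exact: tlift_linear.
have FD x y : F (x + y) = F x + F y by have := Fl 1 x y; rewrite !scale1r.
have F0 : F 0 = 0 by have := Fl (-1) 0 0; rewrite scaler0 addr0 scaleN1r addNr.
have FZ k x : F (k *: x) = k *: F x by have := Fl k x 0; rewrite F0 !addr0.
have FE a b : F (tpure a b) = f a * g b by rewrite /F tlift_pure.
split=> //; first by rewrite FE f1 g1 mulr1.
- move=> x y; change (F (tmul x y) = F x * F y).
  move: x; apply: tensor_homog_ind => [|i j a b|x x' h h'].
  + by rewrite tmul0l F0 mul0r.
  + move: y; apply: tensor_homog_ind => [|k l c d|y y' h h'].
    * by rewrite tmul0r F0 mulr0.
    * rewrite tmul_homog FZ !FE fm gm !fp !gp -!mulrA sscalerAr; congr (_ * _).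
      rewrite [RHS]mulrA [hpart j _ * hpart k _]super_mulC -sscalerAl -mulrA.
      by rewrite andbC.
    * by rewrite tmulDr !FD mulrDr h h'.
  + by rewrite tmulDl !FD mulrDl h h'.
- move=> i x; change (F (thpart i x) = hpart i (F x)).
  move: x; apply: tensor_homog_ind => [|k l a b|x x' h h'].
  + by rewrite thpart0 F0 linear0.
  + rewrite thpart_homog FE fp gp -hpart_mul hpart_proj.
    by case: eqP => _; rewrite ?F0 // FE fp gp hpart_mul.
  + by rewrite thpartD !FD linearD h h'.
Qed.

End TensorLift.

Definition tmap (K : fieldType) (A A' B B' : lmodType K) (f : A -> A') (g : B -> B') :
  tensor A B -> tensor A' B' := tlift (fun a b => tpure (f a) (g b)).

Definition tassoc (K : fieldType) (A B C : lmodType K) :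
  tensor (tensor A B) C -> tensor A (tensor B C) :=
  tlift (fun t c => tlift (fun a b => tpure a (tpure b c)) t).

(* Super-commutative Hopf superalgebras.  An affine supergroup is given by the
   Hopf superalgebra which represents it. *)
Record superHopf (K : fieldType) := SuperHopf {
  hopf_alg :> superComAlg K;
  comul : superhom hopf_alg (tensorSuperAlg hopf_alg hopf_alg);
  counit : superhom hopf_alg (ground K);
  antip : hopf_alg -> hopf_alg;
  antip_linear : linear antip;
  antip_hpart : forall i, {morph antip : a / hpart i a};
  comulA : forall a, tassoc (tmap comul id (comul a)) = tmap id comul (comul a);
  counitl : forall a, tlift (fun x y : hopf_alg => (counit x : K) *: y) (comul a) = a;
  counitr : forall a, tlift (fun x y : hopf_alg => (counit y : K) *: x) (comul a) = a;
  antipl : forall a, tlift (fun x y : hopf_alg => antip x * y) (comul a) =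
    (counit a : K) *: (1 : hopf_alg);
  antipr : forall a, tlift (fun x y : hopf_alg => x * antip y) (comul a) =
    (counit a : K) *: (1 : hopf_alg)
}.

Definition is_subalg (K : fieldType) (A : superAlg K) (S : set A) : Prop :=
  [/\ S 1, forall (k : K) a b, S a -> S b -> S (k *: a + b) &
      forall a b, S a -> S b -> S (a * b)].

Definition finitely_generated (K : fieldType) (A : superAlg K) : Prop :=
  exists s : seq A, forall S : set A,
    is_subalg S -> (forall x, x \in s -> S x) -> S = setT.

Definition algebraic (K : fieldType) (G : superHopf K) : Prop :=
  finitely_generated G.

Definition is_ideal (K : fieldType) (A : superAlg K) (I : set A) : Prop :=
  [/\ I 0, forall a b, I a -> I b -> I (a + b),
      forall a b, I b -> I (a * b) & forall a b, I a -> I (a * b)].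

Definition ideal_gen (K : fieldType) (A : superAlg K) (P : set A) : set A :=
  [set a | forall I : set A, is_ideal I -> (P `<=` I)%classic -> I a]%classic.

Definition odd_part (K : fieldType) (A : superAlg K) : set A :=
  [set a | hpart true a = a]%classic.

Section Supergroup.
Variables (K : fieldType) (G : superHopf K).

(* G(R) *)
Definition point (R : superComAlg K) : Type := superhom G R.

(* f(a_(1)) g(a_(2)) *)
Definition conv (R : superAlg K) (f g : G -> R) (a : G) : R :=
  tlift (fun x y => f x * g y) (comul G a).

Lemma comul_linear : linear (comul G).
Proof. by case: (superhomP (comul G)). Qed.

Lemma conv_linear (R : superAlg K) (f g : G -> R) :
  linear f -> linear g -> linear (conv f g).
Proof.
move=> fl gl k a b; rewrite /conv comul_linear.
exact: (tlift_linear (superhom_mul_bilin fl gl)).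
Qed.

Lemma convA (R : superAlg K) (f g h : G -> R) :
  linear f -> linear g -> linear h -> conv (conv f g) h =1 conv f (conv g h).
Proof.
move=> fl gl hl a.
have bi (C D : lmodType K) (p : C -> R) (q : D -> R) :
    linear p -> linear q -> bilin (fun x y => p x * q y).
  move=> pl ql; split=> c k u v /=; first by rewrite pl mulrDl sscalerAl.
  by rewrite ql mulrDr sscalerAr.
have tb (C C' D D' : lmodType K) (p : C -> C') (q : D -> D') :
    linear p -> linear q -> bilin (fun x y => tpure (p x) (q y)).
  move=> pl ql; split=> c k u v /=; have B := tpure_bilin C' D'.
    by rewrite pl (bilinDl _ _ _ B) (bilinZl _ _ _ B).
  by rewrite ql (bilinDr _ _ _ B) (bilinZr _ _ _ B).
have il (C : lmodType K) : linear (@id C) by [].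
set fg := tlift (fun x y : G => f x * g y).
set gh := tlift (fun x y : G => g x * h y).
have fgl : linear fg by apply/tlift_linear/bi.
have ghl : linear gh by apply/tlift_linear/bi.
pose L := tlift (fun (t : tensor G G) (y : G) => fg t * h y).
pose M := tlift (fun (x : G) (t : tensor G G) => f x * gh t).
have Ll : linear L by apply/tlift_linear/bi.
have Ml : linear M by apply/tlift_linear/bi.
have cl := comul_linear.
have e1 t : L (tmap (comul G) id t) = tlift (fun x y => conv f g x * h y) t.
  move: t; apply: linear_tensor_ext => [k u v||x y].
  - by rewrite /tmap (tlift_linear (tb _ _ _ _ _ _ cl (il _))) Ll.
  - by apply/tlift_linear/bi => //; apply: conv_linear.
  - rewrite /tmap (tlift_pure _ _ (tb _ _ _ _ _ _ cl (il _))) /L.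
    rewrite (tlift_pure _ _ (bi _ _ _ _ fgl hl)).
    by rewrite (tlift_pure _ _ (bi _ _ _ _ (conv_linear fl gl) hl)).
have e2 t : M (tmap id (comul G) t) = tlift (fun x y => f x * conv g h y) t.
  move: t; apply: linear_tensor_ext => [k u v||x y].
  - by rewrite /tmap (tlift_linear (tb _ _ _ _ _ _ (il _) cl)) Ml.
  - by apply/tlift_linear/bi => //; apply: conv_linear.
  - rewrite /tmap (tlift_pure _ _ (tb _ _ _ _ _ _ (il _) cl)) /M.
    rewrite (tlift_pure _ _ (bi _ _ _ _ fl ghl)).
    by rewrite (tlift_pure _ _ (bi _ _ _ _ fl (conv_linear gl hl))).
have ab1 (y : G) : bilin (fun a b : G => tpure a (tpure b y)).
  split=> c k u v /=; have B := tpure_bilin G (tensor G G); have B' := tpure_bilin G G.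
    by rewrite (bilinDl _ _ _ B) (bilinZl _ _ _ B).
  by rewrite (bilinDl _ _ _ B') (bilinZl _ _ _ B') (bilinDr _ _ _ B) (bilinZr _ _ _ B).
have ab2 : bilin (fun (t : tensor G G) (y : G) => tlift (fun a b : G => tpure a (tpure b y)) t).
  split=> [y|t]; first exact/tlift_linear/ab1.
  move=> k u v; move: t; apply: linear_tensor_ext => [|l s t|c d].
  - exact/tlift_linear/ab1.
  - rewrite !(tlift_linear (ab1 _)) !scalerDr !scalerA [k * l]mulrC.
    by rewrite addrACA.
  - rewrite !(tlift_pure _ _ (ab1 _)).
    have B := tpure_bilin G (tensor G G); have B' := tpure_bilin G G.
    by rewrite (bilinDr _ _ _ B') (bilinZr _ _ _ B') (bilinDr _ _ _ B) (bilinZr _ _ _ B).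
have e3 t : M (tassoc t) = L t.
  move: t; apply: linear_tensor_ext => [k u v||t y] //.
    by rewrite /tassoc (tlift_linear ab2) Ml.
  rewrite /tassoc (tlift_pure _ _ ab2) /L (tlift_pure _ _ (bi _ _ _ _ fgl hl)).
  move: t; apply: linear_tensor_ext => [k u v|k u v|x z].
  - by rewrite (tlift_linear (ab1 _)) Ml.
  - by rewrite fgl mulrDl sscalerAl.
  - rewrite (tlift_pure _ _ (ab1 _)) /M (tlift_pure _ _ (bi _ _ _ _ fl ghl)).
    by rewrite /gh /fg !(tlift_pure _ _ (bi _ _ _ _ _ _)) // mulrA.
by rewrite /conv -e1 -e2 -comulA e3.
Qed.

Definition point_mul (R : superComAlg K) (g h : point R) : point R :=
  superhom_comp (SuperHom (tlift_superhom_subproof g h)) (comul G).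

Lemma point_mulE (R : superComAlg K) (g h : point R) : point_mul g h =1 conv g h.
Proof. by []. Qed.

(* G(f) : G(R) -> G(S) *)
Definition point_map (R S : superComAlg K) (f : superhom R S) (g : point R) : point S :=
  superhom_comp f g.

Lemma point_one_subproof (R : superComAlg K) :
  is_superhom (fun a : G => (counit G a : K) *: (1 : R)).
Proof.
case: (superhomP (counit G)) => el e1 em ep; split.
- by move=> k a b; rewrite el scalerDl -scalerA.
- by rewrite e1 scale1r.
- by move=> a b; rewrite em -sscalerAl mul1r scalerA.
- move=> i a; rewrite ep linearZ /=.
  have -> : hpart i (1 : R) = if i then 0 else 1.
    by rewrite -[X in hpart i X]hpart_one hpart_proj hpart_one; case: i.
  by case: i => //=; rewrite /hpart /= ?scaler0 ?scale0r.
Qed.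

Definition point_one (R : superComAlg K) : point R :=
  SuperHom (point_one_subproof R).

(* The inverse of g in G(R), as a map K[G] -> R *)
Definition point_inv (R : superComAlg K) (g : point R) (a : G) : R := g (antip a).

Lemma point_mulA (R : superComAlg K) (g h k : point R) :
  point_mul g (point_mul h k) = point_mul (point_mul g h) k.
Proof.
apply: superhom_eq => a; rewrite !point_mulE.
have [[[gl _ _ _] [hl _ _ _]] [kl _ _ _]] :=
  (superhomP g, superhomP h, superhomP k).
exact: (esym (convA gl hl kl a)).
Qed.

Lemma linear_tlift (R : superAlg K) (F : G -> R) (f : G -> G -> G) t :
  linear F -> bilin f -> F (tlift f t) = tlift (fun x y => F (f x y)) t.
Proof.
move=> Fl bf; have bF : bilin (fun x y => F (f x y)).
  split=> c k u v /=.
    by rewrite (bilinDl _ _ _ bf) (bilinZl _ _ _ bf) Fl.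
  by rewrite (bilinDr _ _ _ bf) (bilinZr _ _ _ bf) Fl.
move: t; apply: linear_tensor_ext => [k u v|k u v|x y].
- by rewrite (tlift_linear bf) Fl.
- by rewrite (tlift_linear bF).
- by rewrite !tlift_pure.
Qed.

Lemma tlift_eq (V : lmodType K) (f g : G -> G -> V) :
  (forall x y, f x y = g x y) -> tlift f =1 tlift g.
Proof. by move=> fg t; apply: eq_bigr. Qed.

Lemma point_mul1l (R : superComAlg K) (g : point R) : point_mul (point_one R) g = g.
Proof.
have [[gl _ _ _] [el _ _ _]] := (superhomP g, superhomP (counit G)).
apply: superhom_eq => a; rewrite point_mulE -[in RHS](counitl a).
rewrite linear_tlift //.
- apply: tlift_eq => x y /=; rewrite -sscalerAl mul1r.
  by rewrite (scalable_linear gl).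
- split=> c k u v /=; first by rewrite el scalerDl scalerA.
  by rewrite scalerDr !scalerA mulrC.
Qed.

Lemma point_mul1r (R : superComAlg K) (g : point R) : point_mul g (point_one R) = g.
Proof.
have [[gl _ _ _] [el _ _ _]] := (superhomP g, superhomP (counit G)).
apply: superhom_eq => a; rewrite point_mulE -[in RHS](counitr a).
rewrite linear_tlift //.
- apply: tlift_eq => x y /=; rewrite -sscalerAr mulr1.
  by rewrite (scalable_linear gl).
- split=> c k u v /=; first by rewrite scalerDr !scalerA mulrC.
  by rewrite el scalerDl scalerA.
Qed.

Lemma point_mulVl (R : superComAlg K) (g : point R) :
  conv (point_inv g) g =1 point_one R.
Proof.
have [gl g1 gm _] := superhomP g.
move=> a; rewrite /= -g1 -(scalable_linear gl) -antipl linear_tlift //.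
- by apply: tlift_eq => x y; rewrite gm.
- by apply: superhom_mul_bilin => //; apply: antip_linear.
Qed.

Lemma point_mulVr (R : superComAlg K) (g : point R) :
  conv g (point_inv g) =1 point_one R.
Proof.
have [gl g1 gm _] := superhomP g.
move=> a; rewrite /= -g1 -(scalable_linear gl) -antipr linear_tlift //.
- by apply: tlift_eq => x y; rewrite gm.
- by apply: superhom_mul_bilin => //; apply: antip_linear.
Qed.

Definition subfunctor := forall R : superComAlg K, set (point R).

(* The closed subfunctor defined by an ideal J: the points which factor through
   K[G]/J. *)
Definition closed_sub (J : set G) : subfunctor :=
  fun R => [set g | forall a, J a -> g a = 0]%classic.

(* The ideal of functions vanishing on N.  When N is closed, this is the ideal J
   with N = closed_sub J, so that K[N] = K[G]/J. *)
Definition ideal_of (N : subfunctor) : set G :=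
  [set a | forall (R : superComAlg K) (g : point R), N R g -> g a = 0]%classic.

Definition Gev : subfunctor := closed_sub (ideal_gen (@odd_part K G)).

(* N_ev for a closed super-subgroup N: K[N]/(K[N]_1) is the quotient of K[G] by
   the ideal generated by ideal_of N and K[G]_1. *)
Definition ev (N : subfunctor) : subfunctor :=
  closed_sub (ideal_gen (ideal_of N `|` @odd_part K G)%classic).

Definition center : subfunctor := fun R =>
  [set g | forall (S : superComAlg K) (f : superhom R S) (h : point S),
     point_mul (point_map f g) h = point_mul h (point_map f g)]%classic.

(* The center of the affine group Gev; only meant for purely even R. *)
Definition center_Gev : subfunctor := fun R =>
  [set g | Gev g /\
     forall (S : superComAlg K) (f : superhom R S) (h : point S),
       purely_even S -> Gev h ->
       point_mul (point_map f g) h = point_mul h (point_map f g)]%classic.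

(* Lie(G) as the space of counit-derivations K[G] -> K; the pairing <v, a> is
   v a.  The sign of the super Leibniz rule disappears since the counit
   vanishes on odd elements. *)
Definition Lie : set (G -> K^o) :=
  [set v : G -> K^o | linear v /\
     forall a b : G, v (a * b) = v a * (counit G b : K) + (counit G a : K) * v b]%classic.

Definition Lie1 : set (G -> K^o) :=
  [set v : G -> K^o | Lie v /\ forall a : G, v (hpart false a) = 0]%classic.

(* Lie(G)_1 (x) R, embedded by the pairing in the space of maps K[G] -> R *)
Definition Lie1_ext (R : superComAlg K) : set (G -> R) :=
  [set u | exists n (v : 'I_n -> G -> K^o) (r : 'I_n -> R),
     (forall i, Lie1 (v i)) /\ u = fun a => \sum_(i < n) v i a *: r i]%classic.

(* The R-linear action of g in Gev(R) on Lie(G)_1 (x) R, u |-> u^g, where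
   <u^g, a> = g^-1(a_(1)) <u, a_(2)> g(a_(3)); a point of Gev factors through
   the quotient map K[G] -> K[Gev], which is therefore not written. *)
Definition rho (R : superComAlg K) (g : point R) (u : G -> R) : G -> R :=
  conv (conv (point_inv g) u) g.

Definition ker_rho : subfunctor := fun R =>
  [set g | Gev g /\ forall u, Lie1_ext u -> rho g u = u]%classic.

End Supergroup.

Arguments ev {K G} N R _.
Arguments Gev {K} G R _.
Arguments center {K} G R _.
Arguments center_Gev {K} G R _.
Arguments ker_rho {K} G R _.

(* Main.v *)
From HB Require Import structures.
Require Import Defs.
From mathcomp Require Import all_boot all_order all_algebra.
From mathcomp Require Import boolp classical_sets.
Set Implicit Arguments.
Unset Strict Implicit.
Unset Printing Implicit Defensive.
Import GRing.Theory.
Local Open Scope ring_scope.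
Local Open Scope classical_set_scope.

(* A point g of G(R), with R purely even, is central iff it commutes with the
   universal point a |-> 1 (x) a of G(R (x) K[G]), that is, iff for all a the
   element g(a_(1)) (x) a_(2) - g(a_(2)) (x) a_(1) of R (x) K[G] vanishes.
   Pairing with functionals on K[G] turns this into equations g(d) = 0 with d in
   the ideal of the center, so the center is closed; applying an odd u in
   Lie(G)_1 (x) R to the second factor gives g u = u g.  Conversely, let g be
   central for Gev and commute with Lie(G)_1.  For a functional f on R put
   y(a) = f(g(a_(1))) a_(2) - f(g(a_(2))) a_(1).  Then y(a) lies in the ideal
   I = (K[G]_1), and y commutes with the right-invariant derivations
   d_v(a) = v(a_(1)) a_(2), v in Lie(G)_1.  So it suffices that a d_v-stable
   subset N of I is zero.  Since K[G] is finitely generated and char K <> 2, I is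
   nilpotent.  The Hopf module I/I^2 is generated by coinvariants, so there are
   odd y_i generating I modulo I^2 and v_i in Lie(G)_1 such that, writing d_i for
   d_{v_i}, d_i(y_i) = 1 mod I and d_i(y_j) = 0 mod I for j < i.
   The composite of the operators 1 - y_i d_i maps I^n into I^(n+1) for n > 0,
   and it is the identity modulo I^(n+1) on elements all of whose derivatives
   lie in I^n.  Hence N is contained in every power of I. *)

(** * Functionals and tensors over a field *)

Definition subspace (K : fieldType) (V : lmodType K) (U : set V) : Prop :=
  U 0 /\ forall (k : K) u w, U u -> U w -> U (k *: u + w).

Section LinearAlgebra.
Variable K : fieldType.

Lemma linear_morphisms (V W : lmodType K) (f : V -> W) : linear f ->
  [/\ f 0 = 0, {morph f : x y / x + y}, {morph f : x / - x},
      {morph f : x y / x - y} & scalable f].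
Proof.
move=> fl.
pose F : {linear V -> W} := HB.pack f (GRing.isLinear.Build K V W *:%R f fl).
split; [exact: (linear0 F) | exact: (linearD F) | exact: (linearN F) |
        exact: (linearB F) | exact: scalable_linear fl].
Qed.

Lemma linear_sum_seq (V W : lmodType K) (f : V -> W) (I : Type) (s : seq I) (E : I -> V) :
  linear f -> f (\sum_(i <- s) E i) = \sum_(i <- s) f (E i).
Proof.
move=> /linear_morphisms[f0 fD _ _ _]; elim: s => [|i s IH]; first by rewrite !big_nil.
by rewrite !big_cons fD IH.
Qed.

Lemma subspaceD (V : lmodType K) (U : set V) u w : subspace U -> U u -> U w -> U (u + w).
Proof. by move=> [_ h] Uu Uw; have := h 1 _ _ Uu Uw; rewrite scale1r. Qed.

Lemma subspaceZ (V : lmodType K) (U : set V) k u : subspace U -> U u -> U (k *: u).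
Proof. by move=> [z h] Uu; have := h k _ _ Uu z; rewrite addr0. Qed.

Lemma subspaceB (V : lmodType K) (U : set V) u w : subspace U -> U u -> U w -> U (u - w).
Proof. by move=> [_ h] Uu Uw; have := h (-1) _ _ Uw Uu; rewrite scaleN1r addrC. Qed.

Definition adjoin (V : lmodType K) (U : set V) (x : V) : set V :=
  [set v | exists k, U (v - k *: x)].

Lemma subspace_adjoin (V : lmodType K) (U : set V) x :
  subspace U -> subspace (adjoin U x).
Proof.
move=> sU; have [U0 UP] := sU; split; first by exists 0; rewrite scale0r subr0.
move=> k u w [a ha] [b hb]; exists (k * a + b).
by rewrite scalerDl -scalerA opprD addrACA -scalerBr; apply: UP.
Qed.

Lemma sub_adjoin (V : lmodType K) (U : set V) x : U `<=` adjoin U x.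
Proof. by move=> u Uu; exists 0; rewrite scale0r subr0. Qed.

Lemma mem_adjoin (V : lmodType K) (U : set V) x : subspace U -> adjoin U x x.
Proof. by case=> U0 _; exists 1; rewrite scale1r subrr. Qed.

Lemma functional_sep (V : lmodType K) (U : set V) (e : V) :
  subspace U -> ~ U e ->
  exists f : V -> K^o, [/\ linear f, forall u, U u -> f u = 0 & f e = 1].
Proof.
move=> sU nUe.
(* Joining [U] to [W] makes the empty chain harmless in Zorn's lemma: its union is empty, and [P]
   then speaks of [U] itself. *)
pose P (W : set V) := subspace (W `|` U) /\ ~ (W `|` U) e.
have [W [[sW nWe] maxW]] : exists A, P A /\ forall B, A `<` B -> ~ P B.
  apply: Zorn_bigcup => F FP Ftot; split; last first.
    by move=> [[X /FP[_ nX] Xe]|//]; apply: nX; left.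
  split; first by right; case: sU.
  have up X u k w : F X -> (X `|` U) u -> (X `|` U) w ->
      (\bigcup_(Y in F) Y `|` U) (k *: u + w).
    move=> FX Xu Xw; have [[_ h] _] := FP _ FX.
    by case: (h k _ _ Xu Xw) => [?|?]; [left; exists X | right].
  move=> k u w [[X FX Xu]|Uu] [[Y FY Yw]|Uw].
  - have [XY|YX] := Ftot _ _ FX FY.
      by apply: (up Y) => //; left=> //; apply: XY.
    by apply: (up X) => //; left=> //; apply: YX.
  - by apply: (up X) => //; [left | right].
  - by apply: (up Y) => //; [right | left].
  - by right; apply: sU.2.
set M := W `|` U in sW nWe.
(* [M] is a hyperplane complementary to the line of [e]: for [x] outside [M], maximality puts [e]
   into [adjoin M x], and the coefficient of [x] there is nonzero because [M] omits [e]. The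
   functional sought is the coordinate [k]. *)
have dec x : exists k, M (x - k *: e).
  have [Mx|nMx] := pselect (M x); first by exists 0; rewrite scale0r subr0.
  have [k Mk] : adjoin M x e.
    apply: contrapT => nM.
    have UM : adjoin M x `|` U = adjoin M x.
      by apply/setUidPl => u Uu; apply: sub_adjoin; right.
    apply: (maxW (adjoin M x)); last first.
      by split; rewrite UM //; apply: subspace_adjoin.
    split; first by move=> u Wu; apply: sub_adjoin; left.
    by move=> sub; apply: nMx; left; apply: sub; apply: mem_adjoin.
  have k0 : k != 0 by apply/eqP => k0; move: Mk; rewrite k0 scale0r subr0.
  exists k^-1; have -> : x - k^-1 *: e = - k^-1 *: (e - k *: x).
    by rewrite scalerBr scalerA mulNr mulVf // !scaleNr scale1r opprK addrC.
  exact: subspaceZ.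
have [f fP] := choice dec.
have uniqf x k : M (x - k *: e) -> f x = k.
  move=> Mk; apply/eqP; rewrite -subr_eq0; apply/eqP; apply: contrapT => /eqP ne.
  apply: nWe; have := subspaceB sW Mk (fP x).
  rewrite opprB addrC addrA subrK -scalerBl => h.
  have := subspaceZ (f x - k)^-1 sW h.
  by rewrite scalerA mulVf // scale1r.
exists f; split.
- move=> k u w; apply: uniqf.
  rewrite scalerDl -[((k : K^o) *: (f u : K^o)) *: e]scalerA opprD addrACA -scalerBr.
  by apply: sW.2; apply: fP.
- by move=> u Uu; apply: uniqf; rewrite scale0r subr0; right.
- by apply: uniqf; rewrite scale1r subrr; apply: sW.1.
Qed.

Fixpoint lspan (V : lmodType K) (s : seq V) : set V :=
  if s is x :: s' then adjoin (lspan s') x else [set 0].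

Lemma subspace_lspan (V : lmodType K) (s : seq V) : subspace (lspan s).
Proof.
elim: s => [|x s IH] /=; last exact: subspace_adjoin.
by split=> // k u w -> ->; rewrite scaler0 addr0.
Qed.

Lemma mem_lspan (V : lmodType K) (s : seq V) x : x \in s -> lspan s x.
Proof.
elim: s => [//|y s IH]; rewrite inE => /orP[/eqP->|/IH xs] /=.
  exact/mem_adjoin/subspace_lspan.
exact: sub_adjoin.
Qed.

Section Tensors.
Variables A B : lmodType K.

Lemma tlift_comp (V W : lmodType K) (F : V -> W) (f : A -> B -> V) t :
  linear F -> bilin f -> F (tlift f t) = tlift (fun x y => F (f x y)) t.
Proof. by move=> Fl bf; rewrite /tlift /tsum (linear_sum_seq _ _ Fl). Qed.

Lemma eq_tlift (V : lmodType K) (f g : A -> B -> V) t :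
  (forall x y, f x y = g x y) -> tlift f t = tlift g t.
Proof. by move=> fg; apply: eq_bigr. Qed.

Lemma bilin_comp (V W : lmodType K) (F : V -> W) (f : A -> B -> V) :
  linear F -> bilin f -> bilin (fun x y => F (f x y)).
Proof.
move=> Fl [fl fr]; split=> [b|a] k u v /=; first by rewrite fl Fl.
by rewrite fr Fl.
Qed.

Lemma bilin_scale (V : lmodType K) (f : A -> K^o) (g : B -> V) :
  linear f -> linear g -> bilin (fun a b => f a *: g b).
Proof.
move=> fl gl; split=> [b|a] k u v /=; first by rewrite fl scalerDl scalerA.
by rewrite gl scalerDr !scalerA mulrC.
Qed.

Lemma bilin_flip (V : lmodType K) (f : A -> B -> V) :
  bilin f -> bilin (fun b a => f a b).
Proof. by case. Qed.

Lemma tensor_repr (t : tensor A B) : exists s, t = \sum_(p <- s) tpure p.1 p.2.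
Proof.
exists (repr t); apply: tensor_ext => V f bf.
rewrite (linear_sum_seq _ _ (tlift_linear bf)).
by apply: eq_bigr => p _; rewrite tlift_pure.
Qed.

(** A left factor that depends linearly on those of [s] is spread over the right factors of [s]. The
    length is recorded because [tensor_sepl] inducts on it. *)
Lemma tensor_absorb (s : seq (A * B)) a b : lspan [seq p.1 | p <- s] a ->
  exists2 s' : seq (A * B), size s' = size s &
    tpure a b + \sum_(p <- s) tpure p.1 p.2 = \sum_(p <- s') tpure p.1 p.2.
Proof.
have [_ [pl pr]] := (erefl tt, tpure_bilin A B).
elim: s a => [|p s IH] a /=.
  move=> ->; exists [::] => //; rewrite !big_nil addr0.
  by have [-> _ _ _ _] := linear_morphisms (pl b).
move=> [k /IH[s' ss e]]; exists ((p.1, p.2 + k *: b) :: s'); first by rewrite /= ss.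
rewrite !big_cons /= -e.
have -> : tpure a b = tpure (a - k *: p.1) b + tpure p.1 (k *: b).
  have [_ _ _ dB dZ] := linear_morphisms (pl b); have [_ _ _ _ dZ'] := linear_morphisms (pr p.1).
  by rewrite dB dZ dZ' subrK.
have [_ -> _ _ _] := linear_morphisms (pr p.1).
by rewrite addrACA [RHS]addrACA; congr (_ + _); apply: addrC.
Qed.

(** Induction on the number of pure terms. If the first left factor depends on the others, its term
    is absorbed; otherwise a functional that is 1 on it and 0 on the others shows that its right
    factor vanishes. *)
Lemma tensor_sepl (t : tensor A B) :
  (forall f : A -> K^o, linear f -> tlift (fun a b => f a *: b) t = 0) -> t = 0.
Proof.
have [s ->] := tensor_repr t.
have [n] := ubnP (size s); elim: n s => // n IH [|p s] /=; first by rewrite big_nil.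
rewrite ltnS => sn h.
have [/(tensor_absorb p.2)[s' ss e]|nsp] := pselect (lspan [seq p.1 | p <- s] p.1).
  have E : \sum_(q <- p :: s) tpure q.1 q.2 = \sum_(q <- s') tpure q.1 q.2 :> tensor A B.
    by rewrite big_cons.
  by rewrite E; apply: IH => [|f fl]; rewrite ?ss // -E h.
have [f [fl f0 f1]] := functional_sep (subspace_lspan _) nsp.
have bf : bilin (fun a (b : B) => f a *: b) by apply: bilin_scale.
suff p20 : p.2 = 0.
  have e : \sum_(q <- p :: s) tpure q.1 q.2 = \sum_(q <- s) tpure q.1 q.2 :> tensor A B.
    rewrite big_cons p20.
    by have [-> _ _ _ _] := linear_morphisms ((tpure_bilin A B).2 p.1); rewrite add0r.
  by rewrite e; apply: IH => // f' f'l; rewrite -e h.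
have := h _ fl; rewrite (linear_sum_seq _ _ (tlift_linear bf)) big_cons.
rewrite tlift_pure // f1 scale1r big_seq big1 ?addr0 // => q qs.
by rewrite tlift_pure // f0 ?scale0r //; apply/mem_lspan/map_f.
Qed.

End Tensors.

Lemma tensor_sepr (A B : lmodType K) (t : tensor A B) :
  (forall f : B -> K^o, linear f -> tlift (fun a b => f b *: a) t = 0) -> t = 0.
Proof.
move=> h; have bf := bilin_flip (tpure_bilin B A); have bf' := bilin_flip (tpure_bilin A B).
have inv (x : tensor A B) : tlift (fun b a => tpure a b) (tlift (fun a b => tpure b a) x) = x.
  move: x; apply: linear_tensor_ext => // [k u v|a b].
    by rewrite (tlift_linear bf) (tlift_linear bf').
  by rewrite !tlift_pure.
rewrite -[t]inv [tlift _ t]tensor_sepl; first by case: (linear_morphisms (tlift_linear bf')).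
move=> f fl; have bs : bilin (fun b (a : A) => f b *: a) by apply: bilin_scale.
rewrite (tlift_comp _ (tlift_linear bs)) //.
by rewrite -[RHS](h f fl); apply: eq_tlift => a b; rewrite tlift_pure.
Qed.

End LinearAlgebra.

(** * Tensor products and purely even quotients of superalgebras *)

Section TensorSuperCommutative.
Variables (K : fieldType) (A B : superComAlg K).

Lemma tensor_super_mulC : super_commutative (tensorSuperAlg A B).
Proof.
move=> i j x y.
change (tmul (thpart i x) (thpart j y) =
  (-1) ^+ (i && j) *: tmul (thpart j y) (thpart i x)).
move: x; apply: tensor_homog_ind => [|k l a b|x x' h h']; first 1 last.
- rewrite thpart_homog; case: eqP => [->|_]; last by rewrite tmul0l tmul0r scaler0.
  move: y; apply: tensor_homog_ind => [|m n c d|y y' h h'].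
  + by rewrite thpart0 tmul0l tmul0r scaler0.
  + rewrite thpart_homog; case: eqP => [->|_]; last by rewrite tmul0l tmul0r scaler0.
    rewrite !tmul_homog [hpart k a * _]super_mulC [hpart l b * _]super_mulC.
    rewrite tpureZl tpureZr !scalerA -!signr_addb; congr (_ ^+ _ *: _).
    by case: k l m n => [] [] [] [].
  + by rewrite !thpartD tmulDl tmulDr scalerDr h h'.
- by rewrite !thpartD tmulDl tmulDr scalerDr h h'.
- by rewrite thpart0 tmul0l tmul0r scaler0.
Qed.

Definition tensorSuperComAlg : superComAlg K := SuperComAlg tensor_super_mulC.

End TensorSuperCommutative.

Section EvenQuotient.
Local Open Scope quotient_scope.
Variables (K : fieldType) (T : superAlg K) (J : set T) (idJ : is_ideal J).

Lemma idealZ k x : J x -> J (k *: x).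
Proof. by case: idJ => _ _ h _ Jx; rewrite -[x]mul1r sscalerAl; apply: h. Qed.

Lemma idealN x : J x -> J (- x).
Proof. by move=> Jx; rewrite -scaleN1r; apply: idealZ. Qed.

Definition jequiv : rel T := fun x y => `[< J (x - y) >].

Lemma jequiv_refl : reflexive jequiv.
Proof. by move=> x; apply/asboolP; rewrite subrr; case: idJ. Qed.

Lemma jequiv_sym : symmetric jequiv.
Proof.
by move=> x y; apply/asboolP/asboolP => /idealN; rewrite opprB.
Qed.

Lemma jequiv_trans : transitive jequiv.
Proof.
move=> y x z /asboolP h1 /asboolP h2; apply/asboolP.
by rewrite -(subrK y x) -addrA; case: (idJ) => _ h _ _; apply: h.
Qed.

Canonical jequiv_rel := EquivRel jequiv jequiv_refl jequiv_sym jequiv_trans.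

Definition jquo := {eq_quot jequiv_rel}.
HB.instance Definition _ := Choice.on jquo.

Definition jproj (x : T) : jquo := \pi_jquo x.

Lemma jprojP x y : (jproj x = jproj y) <-> J (x - y).
Proof.
by split=> [/eqmodP/asboolP|h] //; apply/eqmodP/asboolP.
Qed.

Lemma jprojK (q : jquo) : jproj (repr q) = q.
Proof. exact: reprK. Qed.

Lemma jrepr x : J (repr (jproj x) - x).
Proof. by apply/jprojP; rewrite jprojK. Qed.

Definition jadd (x y : jquo) : jquo := jproj (repr x + repr y).
Definition jscale (k : K) (x : jquo) : jquo := jproj (k *: repr x).
Definition jopp (x : jquo) : jquo := jproj (- repr x).
Definition jmul (x y : jquo) : jquo := jproj (repr x * repr y).

Lemma jprojD x y : jproj (x + y) = jadd (jproj x) (jproj y).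
Proof.
apply/esym/jprojP; rewrite opprD addrACA.
by case: (idJ) => _ h _ _; apply: h; apply: jrepr.
Qed.

Lemma jprojZ k x : jproj (k *: x) = jscale k (jproj x).
Proof. by apply/esym/jprojP; rewrite -scalerBr; apply/idealZ/jrepr. Qed.

Lemma jprojN x : jproj (- x) = jopp (jproj x).
Proof. by apply/esym/jprojP; rewrite -opprD; apply/idealN/jrepr. Qed.

Lemma jprojM x y : jproj (x * y) = jmul (jproj x) (jproj y).
Proof.
apply/esym/jprojP; have [_ JD Jl Jr] := idJ.
set x' := repr _; set y' := repr _.
have -> : x' * y' - x * y = x' * (y' - y) + (x' - x) * y.
  by rewrite mulrBr mulrBl addrA subrK.
by apply: JD; [apply/Jl/jrepr | apply/Jr/jrepr].
Qed.

Lemma jquo_ind (P : jquo -> Prop) : (forall x, P (jproj x)) -> forall q, P q.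
Proof. by move=> h q; rewrite -(jprojK q). Qed.

Lemma jaddA : associative jadd.
Proof.
by elim/jquo_ind=> x; elim/jquo_ind=> y; elim/jquo_ind=> z; rewrite -!jprojD addrA.
Qed.
Lemma jaddC : commutative jadd.
Proof. by elim/jquo_ind=> x; elim/jquo_ind=> y; rewrite -!jprojD addrC. Qed.
Lemma jadd0 : left_id (jproj 0) jadd.
Proof. by elim/jquo_ind=> x; rewrite -jprojD add0r. Qed.
Lemma jaddN : left_inverse (jproj 0) jopp jadd.
Proof. by elim/jquo_ind=> x; rewrite -jprojN -jprojD addNr. Qed.

HB.instance Definition _ := GRing.isZmodule.Build jquo jaddA jaddC jadd0 jaddN.

Lemma jscaleA k l x : jscale k (jscale l x) = jscale (k * l) x.
Proof. by elim/jquo_ind: x => x; rewrite -!jprojZ scalerA. Qed.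
Lemma jscale1 : left_id 1 jscale.
Proof. by elim/jquo_ind=> x; rewrite -jprojZ scale1r. Qed.
Lemma jscaleDr : right_distributive jscale +%R.
Proof.
move=> k; elim/jquo_ind=> x; elim/jquo_ind=> y.
change (jscale k (jadd (jproj x) (jproj y)) =
  jadd (jscale k (jproj x)) (jscale k (jproj y))).
by rewrite -jprojD -!jprojZ -jprojD scalerDr.
Qed.
Lemma jscaleDl x : {morph jscale^~ x : k l / k + l}.
Proof.
by elim/jquo_ind: x => x k l; rewrite -!jprojZ scalerDl jprojD.
Qed.

HB.instance Definition _ :=
  GRing.Zmodule_isLmodule.Build K jquo jscaleA jscale1 jscaleDr jscaleDl.

Lemma jproj_linear : linear jproj.
Proof. by move=> k x y; rewrite jprojD jprojZ. Qed.

Lemma jmulA : associative jmul.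
Proof.
by elim/jquo_ind=> x; elim/jquo_ind=> y; elim/jquo_ind=> z; rewrite -!jprojM mulrA.
Qed.
Lemma jmul1l : left_id (jproj 1) jmul.
Proof. by elim/jquo_ind=> x; rewrite -jprojM mul1r. Qed.
Lemma jmul1r : right_id (jproj 1) jmul.
Proof. by elim/jquo_ind=> x; rewrite -jprojM mulr1. Qed.
Lemma jmul_bilin : bilin jmul.
Proof.
split; elim/jquo_ind=> z k; elim/jquo_ind=> x; elim/jquo_ind=> y /=.
  by rewrite -jproj_linear -!jprojM -jproj_linear mulrDl sscalerAl.
by rewrite -jproj_linear -!jprojM -jproj_linear mulrDr sscalerAr.
Qed.

(** The quotient is declared purely even; the projection respects this grading once the ideal
    contains the odd part. *)
Definition jhpart (i : bool) (q : jquo) : jquo := if i then 0 else q.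

Lemma jhpart_linear i : linear (jhpart i).
Proof. by case: i => k x y //=; rewrite scaler0 addr0. Qed.
Lemma jhpart_sum q : jhpart false q + jhpart true q = q.
Proof. by rewrite /= addr0. Qed.
Lemma jhpart_proj i j q : jhpart i (jhpart j q) = if i == j then jhpart j q else 0.
Proof. by case: i j => [] []. Qed.
Lemma jhpart_mul i j p q : jhpart (i (+) j) (jmul (jhpart i p) (jhpart j q)) =
  jmul (jhpart i p) (jhpart j q).
Proof.
have [l r] := jmul_bilin; have z q' : jmul 0 q' = 0 by case: (linear_morphisms (l q')).
have z' q' : jmul q' 0 = 0 by case: (linear_morphisms (r q')).
by case: i j => [] [] //=; rewrite ?z ?z'.
Qed.

Definition evenQuotientAlg : superAlg K :=
  @SuperAlg K jquo (jproj 1) jmul jhpart jmulA jmul1l jmul1r jmul_bilin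
    jhpart_linear jhpart_sum jhpart_proj (erefl _) jhpart_mul.

Hypothesis Jodd : @odd_part K T `<=` J.
Hypothesis Jcomm : forall x y, J (x * y - y * x).

Lemma evenQuotient_super_mulC : super_commutative evenQuotientAlg.
Proof.
move=> i j p q; change (jmul (jhpart i p) (jhpart j q) =
  (-1) ^+ (i && j) *: jmul (jhpart j q) (jhpart i p)).
have [l r] := jmul_bilin; have z q' : jmul 0 q' = 0 by case: (linear_morphisms (l q')).
have z' q' : jmul q' 0 = 0 by case: (linear_morphisms (r q')).
case: i j => [] [] //=; rewrite ?z ?z' ?scaler0 // expr0 scale1r.
by elim/jquo_ind: p => x; elim/jquo_ind: q => y; rewrite -!jprojM; apply/jprojP.
Qed.

Definition evenQuotient : superComAlg K := SuperComAlg evenQuotient_super_mulC.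

Lemma evenQuotient_proj_superhom : @is_superhom K T evenQuotient jproj.
Proof.
split=> [|//|x y|i x]; [exact: jproj_linear|exact: jprojM|].
have od : jproj (hpart true x) = 0.
  by apply/jprojP; rewrite subr0; apply: Jodd; rewrite /odd_part /= hpart_proj.
have [_ dD _ _ _] := linear_morphisms jproj_linear.
case: i => //; change (jproj (hpart false x) = jproj x).
by rewrite -[in RHS](hpart_sum x) dD od addr0.
Qed.

Definition evenQuotient_proj : superhom T evenQuotient :=
  SuperHom evenQuotient_proj_superhom.

Lemma evenQuotient_proj_eq0 x : evenQuotient_proj x = 0 -> J x.
Proof. by move=> e; rewrite -[x]subr0; apply/jprojP. Qed.

End EvenQuotient.

(** * Powers of the ideal of odd elements *)

Section Powers.
Variables (K : fieldType) (A : superComAlg K).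

Lemma hpart_even_odd (a : A) : hpart false (hpart true a) = 0.
Proof. by rewrite hpart_proj. Qed.

Lemma hpart_odd_even (a : A) : hpart true (hpart false a) = 0.
Proof. by rewrite hpart_proj. Qed.

Lemma hpart_idem i (a : A) : hpart i (hpart i a) = hpart i a.
Proof. by rewrite hpart_proj eqxx. Qed.

Lemma evenC (a b : A) : hpart false a * b = b * hpart false a.
Proof.
rewrite -(hpart_sum b) mulrDr mulrDl.
by rewrite [hpart false a * hpart true b]super_mulC
  [hpart false a * hpart false b]super_mulC /= expr0 !scale1r.
Qed.

Lemma oddC (x y : A) : hpart true x = x -> hpart true y = y -> x * y = - (y * x).
Proof. by move=> <- <-; rewrite super_mulC expr1 scaleN1r. Qed.

(** The parity automorphism, [(-1)^|a| a] on homogeneous elements; it records the sign of moving an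
    odd factor past [a]. *)
Definition sgn (a : A) : A := hpart false a - hpart true a.

Lemma sgn_linear : linear sgn.
Proof.
by move=> k a b; rewrite /sgn !hpart_linear scalerBr opprD addrACA.
Qed.

Lemma sgn_odd (x : A) : hpart true x = x -> sgn x = - x.
Proof. by move=> xo; rewrite /sgn -xo hpart_even_odd hpart_idem sub0r. Qed.

Lemma sgn_hpart i (x : A) : sgn (hpart i x) = (-1) ^+ i *: hpart i x.
Proof.
case: i; first by rewrite sgn_odd ?hpart_idem // expr1 scaleN1r.
by rewrite /sgn hpart_idem hpart_odd_even subr0 scale1r.
Qed.

Lemma mul_odd_sgn (a x : A) : hpart true x = x -> a * x = x * sgn a.
Proof.
move=> xo; rewrite -[in LHS](hpart_sum a) mulrDl /sgn mulrBr.
by rewrite evenC (oddC (hpart_idem true a) xo).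
Qed.

Lemma hpart_mul_true (a b : A) :
  hpart true (a * b) = hpart false a * hpart true b + hpart true a * hpart false b.
Proof.
rewrite -[in LHS](hpart_sum a) -[in LHS](hpart_sum b) !(mulrDl, mulrDr) !linearD /=.
rewrite -(hpart_mul false false) -(hpart_mul true true) /= !hpart_odd_even.
by rewrite (hpart_mul true false) (hpart_mul false true) addr0 add0r addrC.
Qed.

Lemma hpart_mul_false (a b : A) :
  hpart false (a * b) = hpart false a * hpart false b + hpart true a * hpart true b.
Proof.
rewrite -[in LHS](hpart_sum a) -[in LHS](hpart_sum b) !(mulrDl, mulrDr) !linearD /=.
rewrite -(hpart_mul true false) -(hpart_mul false true) /= !hpart_even_odd.
by rewrite (hpart_mul false false) (hpart_mul true true) addr0 add0r.
Qed.

(* ipow n is I^n, where I is the ideal generated by the odd elements. *)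
Inductive ipow : nat -> A -> Prop :=
| ipow_top a : ipow 0 a
| ipow0 n : ipow n 0
| ipowD n a b : ipow n a -> ipow n b -> ipow n (a + b)
| ipowS n x b : hpart true x = x -> ipow n b -> ipow n.+1 (x * b).

Lemma ipowMr n a c : ipow n a -> ipow n (a * c).
Proof.
elim=> {n a} [a|n|n a b _ IHa _ IHb|n x b xo _ IH].
- exact: ipow_top.
- by rewrite mul0r; apply: ipow0.
- by rewrite mulrDl; apply: ipowD.
- by rewrite -mulrA; apply: ipowS.
Qed.

(** A left factor [c] passes an odd [x] by [c x = x sgn(c)], so the powers, generated by odd factors
    on the left, are two-sided ideals. *)
Lemma ipowMl n a c : ipow n a -> ipow n (c * a).
Proof.
move=> h; elim: h c => {n a} [a|n|n a b _ IHa _ IHb|n x b xo _ IH] c.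
- exact: ipow_top.
- by rewrite mulr0; apply: ipow0.
- by rewrite mulrDr; apply: ipowD.
- by rewrite mulrA [c * x]mul_odd_sgn // -mulrA; apply: ipowS.
Qed.

Lemma ipowZ n k a : ipow n a -> ipow n (k *: a).
Proof. by move=> h; rewrite -[a]mul1r sscalerAl; apply: ipowMl. Qed.

Lemma ipowN n a : ipow n a -> ipow n (- a).
Proof. by rewrite -scaleN1r; apply: ipowZ. Qed.

Lemma ipowB n a b : ipow n a -> ipow n b -> ipow n (a - b).
Proof. by move=> ha hb; apply: ipowD => //; apply: ipowN. Qed.

Lemma ipow_odd x : hpart true x = x -> ipow 1 x.
Proof. by move=> xo; rewrite -[x]mulr1; apply: ipowS => //; apply: ipow_top. Qed.

Lemma ipow_hpart x : ipow 1 (hpart true x).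
Proof. exact/ipow_odd/hpart_idem. Qed.

Lemma ipowM1 n x b : ipow 1 x -> ipow n b -> ipow n.+1 (x * b).
Proof.
move=> h hb; move: h; move e : 1%N => m h.
elim: h e => {m x} [//|n'|n' a c _ IHa _ IHc|n' x c xo _ _] e.
- by rewrite mul0r; apply: ipow0.
- by rewrite mulrDl; apply: ipowD; [apply: IHa | apply: IHc].
- by rewrite -mulrA; apply: ipowS => //; apply: ipowMl.
Qed.

Lemma ipowM2 n x b : ipow 2 x -> ipow n b -> ipow n.+2 (x * b).
Proof.
move=> h hb; move: h; move e : 2%N => m h.
elim: h e => {m x} [//|n'|n' a c _ IHa _ IHc|n' x c xo hc _] e.
- by rewrite mul0r; apply: ipow0.
- by rewrite mulrDl; apply: ipowD; [apply: IHa | apply: IHc].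
- rewrite -mulrA; apply: ipowS => //; apply: ipowM1 => //.
  by case: e hc => <-.
Qed.

(** In a product [x c] with [x] odd, only the odd part of [c] contributes to the even part. *)
Lemma ipow1_even a : ipow 1 a -> ipow 2 (hpart false a).
Proof.
move e : 1%N => m h; elim: h e => {m a} [//|n'|n' a c _ IHa _ IHc|n' x c xo hc _] e.
- by rewrite linear0; apply: ipow0.
- by rewrite linearD; apply: ipowD; [apply: IHa | apply: IHc].
- have x0 : hpart false x = 0 by rewrite -xo hpart_even_odd.
  rewrite hpart_mul_false x0 mul0r add0r xo.
  by case: e => <-; apply: ipowS => //; apply: ipow_hpart.
Qed.

(** * Nilpotency of the ideal of odd elements *)

Section Nilpotent.
Hypothesis charK : 2%N \notin [pchar K].

Lemma odd_sq (x : A) : hpart true x = x -> x * x = 0.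
Proof.
move=> xo; have e := oddC xo xo.
have two0 : (2%:R : K) != 0 by apply: contra charK => h; rewrite inE /= h.
have : (2%:R : K) *: (x * x) = 0.
  by rewrite scaler_nat mulr2n {1}e addNr.
by move/(congr1 (fun z => (2%:R : K)^-1 *: z)); rewrite scalerA mulVf // scale1r scaler0.
Qed.

(* Odd elements anticommute and square to zero, so products of n generators
   reduce to products along length-n subsequences of zs. *)
Fixpoint mon (zs : seq A) (n : nat) : set A :=
  match n, zs with
  | 0, _ => setT
  | _.+1, [::] => [set 0]
  | n'.+1, z :: zs' => [set a | exists b c, [/\ mon zs' n' b, mon zs' n c & a = z * b + c]]
  end.

Lemma mon_top zs a : mon zs 0 a.
Proof. by case: zs. Qed.

Lemma mon_zero zs n : mon zs n 0.
Proof.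
elim: zs n => [|z zs IH] [|n] //=; exists 0, 0; split; rewrite ?mulr0 ?addr0 //; exact: IH.
Qed.

Lemma monD zs n a b : mon zs n a -> mon zs n b -> mon zs n (a + b).
Proof.
elim: zs n a b => [|z zs IH] [|n] a b //=; first by move=> -> ->; rewrite addr0.
move=> [x [y [hx hy ->]]] [x' [y' [hx' hy' ->]]]; exists (x + x'), (y + y').
by split; [apply: IH | apply: IH | rewrite mulrDr addrACA].
Qed.

Lemma monMr zs n a c : mon zs n a -> mon zs n (a * c).
Proof.
elim: zs n a => [|z zs IH] [|n] a //=; first by move=> ->; rewrite mul0r.
move=> [x [y [hx hy ->]]]; exists (x * c), (y * c).
by split; [apply: IH | apply: IH | rewrite mulrDl mulrA].
Qed.

Definition all_odd (zs : seq A) := forall z, z \in zs -> hpart true z = z.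

Lemma all_odd_cons z zs : all_odd (z :: zs) -> hpart true z = z /\ all_odd zs.
Proof.
move=> h; split; first by apply: h; rewrite mem_head.
by move=> x xs; apply: h; rewrite inE xs orbT.
Qed.

Lemma monMl zs n a c : all_odd zs -> mon zs n a -> mon zs n (c * a).
Proof.
elim: zs n a c => [|z zs IH] [|n] a c //=; first by move=> _ ->; rewrite mulr0.
move=> /all_odd_cons[zo zso] [x [y [hx hy ->]]]; exists (sgn c * x), (c * y).
by split; [apply: IH | apply: IH | rewrite mulrDr mulrA [c * z]mul_odd_sgn // -mulrA].
Qed.

(** If [z] is the head of the list, [z^2 = 0] removes the terms that already contain it and [z]
    takes the head position in the others; if [z] comes later, it anticommutes past the head and is
    inserted further down. *)
Lemma monS zs n z b : all_odd zs -> z \in zs -> mon zs n b -> mon zs n.+1 (z * b).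
Proof.
elim: zs n b => [//|x zs IH] n b /all_odd_cons[xo zso].
rewrite inE => /orP[/eqP->|zzs].
  case: n => [|n] /=; first by exists b, 0; split; rewrite ?addr0 //;
    [apply: mon_top | apply: mon_zero].
  move=> [c [d [hc hd ->]]]; exists d, 0; split; rewrite ?addr0 //; first exact: mon_zero.
  by rewrite mulrDr mulrA odd_sq // mul0r add0r.
case: n => [|n] /=.
  move=> _; exists 0, (z * b); split; rewrite ?mulr0 ?add0r //; first exact: mon_top.
  by apply: IH => //; apply: mon_top.
move=> [c [d [hc hd ->]]]; exists (- z * c), (z * d); split.
- by rewrite mulNr -mulrN; apply: IH => //; rewrite -mulN1r; apply: monMl.
- exact: IH.
- by rewrite mulrDr !mulrA mulrN mulNr (oddC (zso _ zzs) xo) mulNr.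
Qed.

(** A list has no subsequence longer than itself; through [ipow_mon] this makes the ideal
    nilpotent. *)
Lemma mon_big zs n : (size zs < n)%N -> mon zs n `<=` [set 0].
Proof.
elim: zs n => [|z zs IH] [|n] //= sn a //; move=> [b [c [hb hc ->]]] /=.
by rewrite (IH n _ _ hb) // (IH n.+1 _ _ hc) ?mulr0 ?addr0 // ltnW.
Qed.

Section Generators.
Variable zs : seq A.
Hypothesis zso : all_odd zs.
Hypothesis zs_gen : forall x : A, mon zs 1 (hpart true x).

Lemma ipow_mon n : ipow n `<=` mon zs n.
Proof.
move=> a; elim=> {n a} [a|n|n a b _ IHa _ IHb|n x b xo _ IH].
- exact: mon_top.
- exact: mon_zero.
- exact: monD.
(* The odd factor is expanded over generators. The list [ws] is separated from [zs] so that the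
   induction can shorten it while the target keeps all of [zs]. *)
rewrite -xo; suff gen : forall ws y, (forall z, z \in ws -> z \in zs) -> mon ws 1 y ->
    mon zs n.+1 (y * b).
  exact: (gen zs _ (fun z h => h) (zs_gen x)).
elim=> [|w ws IHws] y sub /=; first by move=> ->; rewrite mul0r; apply: mon_zero.
move=> [c [d [_ hd ->]]]; rewrite mulrDl -mulrA; apply: monD.
  by apply: monS; rewrite // ?sub ?mem_head //; apply: monMl.
by apply: IHws hd => z zws; apply: sub; rewrite inE zws orbT.
Qed.

Lemma ipow_nil : ipow (size zs).+1 `<=` [set 0].
Proof. by move=> a /ipow_mon; apply: mon_big. Qed.

End Generators.

(** The odd parts of algebra generators suffice: the elements whose odd part lies in the ideal of
    these form a subalgebra containing the generators. *)
Lemma odd_generators : finitely_generated A ->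
  exists2 zs : seq A, all_odd zs & forall x : A, mon zs 1 (hpart true x).
Proof.
move=> [s sgen]; pose zs := [seq hpart true x | x <- s].
have zso : all_odd zs by move=> z /mapP[x _ ->]; rewrite hpart_idem.
exists zs => // x; have mD := @monD zs 1; have mr := @monMr zs 1.
suff e : [set a | mon zs 1 (hpart true a)] = setT.
  by have : [set a | mon zs 1 (hpart true a)] x by rewrite e.
apply: sgen; last first.
  move=> y ys /=; rewrite -[hpart true y]mulr1; apply: monS => //; last exact: mon_top.
  exact: map_f.
split=> /=.
- by rewrite -hpart_one hpart_odd_even; apply: mon_zero.
- move=> k a b ha hb; rewrite hpart_linear; apply: mD => //.
  by rewrite -[hpart true a]mul1r sscalerAl; apply: monMl.
- move=> a b ha hb; rewrite hpart_mul_true; apply: mD; last exact: mr.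
  exact: monMl.
Qed.

End Nilpotent.
End Powers.

(** * Odd derivations and coinvariants *)

Section Convolution.
Variables (K : fieldType) (G : superHopf K).

Lemma tlift_mem (A B V : lmodType K) (Q : set V) (f : A -> B -> V) t :
  Q 0 -> (forall u v, Q u -> Q v -> Q (u + v)) -> (forall a b, Q (f a b)) ->
  Q (tlift f t).
Proof. by move=> Q0 QD Qf; rewrite /tlift /tsum; apply: big_ind. Qed.

Lemma tliftD (A B V : lmodType K) (f g : A -> B -> V) t :
  tlift (fun a b => f a b + g a b) t = tlift f t + tlift g t.
Proof. by rewrite /tlift /tsum big_split. Qed.

Lemma tliftB (A B V : lmodType K) (f g : A -> B -> V) t :
  tlift (fun a b => f a b - g a b) t = tlift f t - tlift g t.
Proof. by rewrite /tlift /tsum sumrB. Qed.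

Lemma tliftZ (A B V : lmodType K) (f : A -> B -> V) k t :
  tlift (fun a b => k *: f a b) t = k *: tlift f t.
Proof. by rewrite /tlift /tsum scaler_sumr. Qed.

Lemma antip_lin : linear (@antip K G).
Proof. exact: antip_linear. Qed.

Lemma counit_lin : linear (fun a => (counit G a : K^o)).
Proof. by case: (superhomP (counit G)). Qed.

Lemma counitP k (a b : G) :
  (counit G (k *: a + b) : K) = k * (counit G a : K) + (counit G b : K).
Proof. exact: counit_lin. Qed.

Lemma counit_odd (a : G) : (counit G (hpart true a) : K) = 0.
Proof. by case: (superhomP (counit G)) => _ _ _ h; rewrite h. Qed.

Lemma comul_hpart i (a : G) : comul G (hpart i a) = thpart i (comul G a).
Proof. by case: (superhomP (comul G)) => _ _ _ h; apply: h. Qed.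

Lemma comulM (a b : G) : comul G (a * b) = tmul (comul G a) (comul G b).
Proof. by case: (superhomP (comul G)) => _ _ h _; apply: h. Qed.

Definition unitmap (R : superAlg K) (a : G) : R := (counit G a : K) *: (1 : R).

Lemma conv_unitr (R : superAlg K) (f : G -> R) : linear f -> conv f (unitmap R) =1 f.
Proof.
move=> fl a; rewrite -[in RHS](counitr a) linear_tlift //; last first.
  by apply/bilin_flip/bilin_scale => //; apply: counit_lin.
have [_ _ _ _ fZ] := linear_morphisms fl.
by apply: tlift_eq => x y; rewrite fZ /unitmap -sscalerAr mulr1.
Qed.

Lemma conv_unitl (R : superAlg K) (f : G -> R) : linear f -> conv (unitmap R) f =1 f.
Proof.
move=> fl a; rewrite -[in RHS](counitl a) linear_tlift //; last first.
  by apply: bilin_scale => //; apply: counit_lin.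
have [_ _ _ _ fZ] := linear_morphisms fl.
by apply: tlift_eq => x y; rewrite fZ /unitmap -sscalerAl mul1r.
Qed.

Lemma eq_conv (R : superAlg K) (f f' g g' : G -> R) :
  f =1 f' -> g =1 g' -> conv f g =1 conv f' g'.
Proof. by move=> ff gg a; apply: eq_tlift => x y; rewrite ff gg. Qed.

Lemma conv_antipl : conv (@antip K G) id =1 unitmap G.
Proof. exact: antipl. Qed.

Lemma conv_antipr : conv id (@antip K G) =1 unitmap G.
Proof. exact: antipr. Qed.

(** Comultiplication is even, so the parities of the two factors in the coproduct of an element of
    parity [k] add up to [k]; only such pairs need testing. *)
Lemma comul_parity (V : lmodType K) (Q : set V) (f : G -> G -> V) k a :
  bilin f -> Q 0 -> (forall u v, Q u -> Q v -> Q (u + v)) ->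
  (forall i x y, Q (f (hpart i x) (hpart (i (+) k) y))) ->
  Q (tlift f (comul G (hpart k a))).
Proof.
move=> bf Q0 QD Qf; rewrite comul_hpart /thpart.
have fl := tlift_linear bf.
rewrite (tlift_comp _ fl (thpart_bilin _ _ _)); apply: tlift_mem => // x y.
by rewrite linear_sum_seq //; apply: big_ind => // i _; rewrite tlift_pure.
Qed.

(** Reduces a product formula modulo [Q] to homogeneous pure tensors, where the sign is explicit. It
    serves with [Q] zero in [derM] and with [Q] equal to I^2 in [coinvM]. *)
Lemma tlift_tmul (V : lmodType K) (Q : set V) (f : G -> G -> V)
    (r : tensor G G -> tensor G G -> V) s t :
  bilin f -> bilin r -> Q 0 -> (forall u v, Q u -> Q v -> Q (u + v)) ->
  (forall k i j l a b c d,
    Q ((-1) ^+ (i && j) *: f (hpart k a * hpart j c) (hpart i b * hpart l d)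
       - r (tpure (hpart k a) (hpart i b)) (tpure (hpart j c) (hpart l d)))) ->
  Q (tlift f (tmul s t) - r s t).
Proof.
move=> bf [rl rr] Q0 QD Qp; have [f0 fD _ _ fZ] := linear_morphisms (tlift_linear bf).
move: s; apply: tensor_homog_ind => [|k i a b|s s' hs hs'].
- by rewrite tmul0l f0; have [-> _ _ _ _] := linear_morphisms (rl t); rewrite subr0.
- move: t; apply: tensor_homog_ind => [|j l c d|t t' ht ht'].
  + rewrite tmul0r f0; have [-> _ _ _ _] := linear_morphisms (rr (tpure (hpart k a) (hpart i b))).
    by rewrite subr0.
  + by rewrite tmul_homog fZ tlift_pure.
  + rewrite tmulDr fD; have [_ -> _ _ _] := linear_morphisms (rr (tpure (hpart k a) (hpart i b))).
    by rewrite opprD addrACA; apply: QD.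
- rewrite tmulDl fD; have [_ -> _ _ _] := linear_morphisms (rl t).
  by rewrite opprD addrACA; apply: QD.
Qed.

End Convolution.

Section Derivations.
Variables (K : fieldType) (G : superHopf K).
Implicit Types (v : G -> K^o) (a b : G).

(* For v in Lie(G)_1 this is an odd right-invariant superderivation of K[G]. *)
Definition der v a : G := tlift (fun x y => v x *: y) (comul G a).

Definition unit_mul (R : superAlg K) v a : R := v a *: (1 : R).

Lemma unit_mul_linear (R : superAlg K) v : linear v -> linear (unit_mul R v).
Proof. by move=> vl k a b; rewrite /unit_mul vl scalerDl -scalerA. Qed.

Lemma der_conv v a : der v a = conv (unit_mul G v) id a.
Proof. by apply: eq_tlift => x y; rewrite /unit_mul -sscalerAl mul1r. Qed.

Lemma der_bilin v : linear v -> bilin (fun x y : G => v x *: y).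
Proof. by move=> vl; apply: bilin_scale. Qed.

Lemma der_linear v : linear v -> linear (der v).
Proof.
move=> vl k a b; rewrite /der comul_linear.
exact: (tlift_linear (der_bilin vl)).
Qed.

(** The left side is the sum of [(-1)^(|a_2||b_1|) v(a_1 b_1) a_2 b_2]. After the Leibniz rule for
    [v], the counit kills odd [b_1] in one term, so no sign remains; in the other, [v] kills even
    [b_1], so the sign becomes that of [sgn]. *)
Lemma derM v a b : Lie1 v -> der v (a * b) = der v a * b + sgn a * der v b.
Proof.
move=> [[vl vM] v0].
have be g : linear g -> bilin (fun x y : G => (counit G x : K) *: (g y : G)).
  by move=> gl; apply: bilin_scale => //; apply: counit_lin.
have idl : linear (fun y : G => y) by [].
have bv : bilin (fun x y : G => v x *: y) by apply: bilin_scale.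
have cu g : linear g -> g a = tlift (fun x y : G => (counit G x : K) *: (g y : G)) (comul G a).
  move=> gl; rewrite -[in LHS](counitl a) (linear_tlift _ gl) //; last exact: be idl.
  by have [_ _ _ _ gZ] := linear_morphisms gl; apply: tlift_eq => x y; rewrite gZ.
have sl := @sgn_linear K G.
pose D (t : tensor G G) : G := tlift (fun x y : G => v x *: y) t.
pose E (t : tensor G G) : G := tlift (fun x y : G => (counit G x : K) *: y) t.
pose S (t : tensor G G) : G := tlift (fun x y : G => (counit G x : K) *: sgn y) t.
have Dl : linear D by apply: tlift_linear.
have El : linear E by apply: tlift_linear; apply: be idl.
have Sl : linear S by apply: tlift_linear; apply: be sl.
have Dp x y : D (tpure x y) = v x *: y by apply: tlift_pure.
have Ep x y : E (tpure x y) = (counit G x : K) *: y by apply: tlift_pure; apply: be idl.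
have Sp x y : S (tpure x y) = (counit G x : K) *: sgn y by apply: tlift_pure; apply: be sl.
pose r (s t : tensor G G) : G := D s * E t + S s * D t.
have br : bilin r.
  split=> u k s t; rewrite /r Dl ?Sl ?El.
    by rewrite !mulrDl scalerDr -!sscalerAl addrACA.
  by rewrite !mulrDr scalerDr -!sscalerAr addrACA.
have Ea : E (comul G b) = b by apply: counitl.
have Sa : S (comul G a) = sgn a by rewrite (cu _ sl).
apply/eqP; rewrite -subr_eq0; apply/eqP.
have -> : der v a * b + sgn a * der v b = r (comul G a) (comul G b) by rewrite /r Ea Sa.
rewrite /der comulM.
apply: (tlift_tmul (Q := [set 0])) => //= [u w -> ->|k i j l c d e f]; first by rewrite addr0.
apply/eqP; rewrite subr_eq0; apply/eqP.
rewrite /r !Dp Ep Sp sgn_hpart vM.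
rewrite scalerDl scalerDr; congr (_ + _).
  rewrite -sscalerAl -sscalerAr [in RHS]scalerA; case: j => /=.
    by rewrite counit_odd mulr0 !scale0r scaler0.
  by rewrite andbF expr0 scale1r.
rewrite -!sscalerAl -sscalerAr !scalerA; congr (_ *: _).
case: j => /=; last by rewrite v0 !mulr0.
by rewrite andbT mulrA [_ ^+ _ * _]mulrC.
Qed.

(** [v] sees only odd first factors, and for an even argument the second factor is then odd too. *)
Lemma der_even v a : Lie1 v -> ipow 1 (der v (hpart false a)).
Proof.
move=> [[vl vM] v0]; apply: comul_parity.
- exact: bilin_scale.
- exact: ipow0.
- by move=> u w; apply: ipowD.
- move=> [] x y /=; first exact/ipowZ/ipow_hpart.
  by rewrite v0 scale0r; apply: ipow0.
Qed.

(** By the Leibniz rule, differentiation removes at most one odd factor. *)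
Lemma der_ipow v n a : Lie1 v -> ipow n.+1 a -> ipow n (der v a).
Proof.
move=> Lv; have [[vl _] _] := Lv; have [d0 dD _ _ _] := linear_morphisms (der_linear vl).
move e : n.+1 => m h; elim: h n e => {m a} [//|m|m a b _ IHa _ IHb|m x b xo hb IH] n e.
- by rewrite d0; apply: ipow0.
- by rewrite dD; apply: ipowD; [apply: IHa | apply: IHb].
- rewrite derM //; case: e hb IH => <- hb IH; apply: ipowD; first exact: ipowMl.
  rewrite sgn_odd //; case: n hb IH => [|n] hb IH; first exact: ipow_top.
  by rewrite mulNr; apply: ipowN; apply: ipowS => //; apply: IH.
Qed.

End Derivations.

(** * Coinvariants of I/I^2 and their Leibniz rule *)

Section Coinvariants.
Variables (K : fieldType) (G : superHopf K).
Implicit Types (v : G -> K^o) (a b : G).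
Local Notation h0 := (@hpart K G false).
Local Notation h1 := (@hpart K G true).

(* Modulo I^2, this is the projection onto the right K[Gev]-coinvariants of the
   Hopf module I/I^2, where I = (K[G]_1). *)
Definition coinv : G -> G := conv h1 (@antip K G).

Lemma coinv_linear : linear coinv.
Proof. by apply: conv_linear; [apply: hpart_linear | apply: antip_lin]. Qed.

Lemma conv_ipow m n (f g : G -> G) a :
  (forall x, ipow m (f x)) -> (forall x, ipow n (g x)) -> (m <= 2)%N ->
  ipow (m + n) (conv f g a).
Proof.
move=> hf hg m2; apply: tlift_mem => [|u w|x y]; [exact: ipow0 | exact: ipowD |].
case: m m2 hf => [|[|[|m]]] // _ hf; [exact: ipowMl | exact: ipowM1 | exact: ipowM2].
Qed.

Lemma coinv_ipow a : ipow 1 (coinv a).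
Proof.
by apply: (@conv_ipow 1 0) => // x; [apply: ipow_hpart | apply: ipow_top].
Qed.

(** The antipode cancels in [h1(a_1) S(a_2) a_3]. Hence the values of [coinv] generate all odd
    elements. *)
Lemma conv_coinv_id a : conv coinv id a = h1 a.
Proof.
have hl := @hpart_linear K G true; have al := @antip_lin K G.
rewrite /coinv (convA hl al) // (eq_conv (fun=> erefl) (@conv_antipl K G)).
exact: conv_unitr.
Qed.

Lemma conv_coinv_even a : ipow 2 (conv coinv h0 a - h1 a).
Proof.
rewrite -conv_coinv_id /conv -tliftB; apply: tlift_mem => [|u w|x y]; first exact: ipow0.
  exact: ipowD.
rewrite -mulrBr; apply: ipowM1; first exact: coinv_ipow.
by rewrite -[X in _ - X]hpart_sum opprD addrA subrr sub0r; apply/ipowN/ipow_hpart.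
Qed.

(** For even [a], an odd [a_1] comes with an odd [a_2], and the antipode keeps parity, so each term
    is a product of two odd elements. *)
Lemma coinv_even a : ipow 2 (coinv (h0 a)).
Proof.
apply: comul_parity => [|||[] x y] /=.
- by apply: superhom_mul_bilin; [apply: hpart_linear | apply: antip_lin].
- exact: ipow0.
- by move=> u w; apply: ipowD.
- rewrite antip_hpart; apply: ipowM1; exact: ipow_hpart.
- by rewrite hpart_odd_even mul0r; apply: ipow0.
Qed.

(** [F] is recovered from the convolution of [F] and [id] by convolving with the antipode, and
    replacing [id] by [h0] costs only a term in I^2. Thus vanishing modulo I^2 can be tested after
    convolving with [h0]. *)
Lemma conv_even_inj (F : G -> G) : linear F -> (forall x, ipow 1 (F x)) ->
  (forall x, ipow 2 (conv F h0 x)) -> forall x, ipow 2 (F x).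
Proof.
move=> Fl F1 F2 x; rewrite -(conv_unitr Fl).
rewrite -(eq_conv (fun=> erefl) (@conv_antipr K G)) -convA //; last exact: antip_lin.
apply: (@conv_ipow 2 0) => // [y|y]; last exact: ipow_top.
have -> : conv F id y = conv F h0 y + conv F h1 y.
  by rewrite /conv -tliftD; apply: eq_tlift => u w; rewrite -mulrDr hpart_sum.
apply: ipowD => //; apply: (@conv_ipow 1 1) => // u; exact: ipow_hpart.
Qed.

(** The Leibniz defect [E] is tested after convolving with [h0] in each variable, by
    [conv_even_inj]. There [coinv] turns into [h1] modulo I^2, and the rule follows from
    [h1(xy) = h0(x) h1(y) + h1(x) h0(y)]. *)
Lemma coinvM a b : ipow 2 (coinv (a * b) -
  ((counit G a : K) *: coinv b + (counit G b : K) *: coinv a)).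
Proof.
have cl := coinv_linear; have el := @counit_lin K G.
have hl := @hpart_linear K G false.
pose E x y : G := coinv (x * y) - ((counit G x : K) *: coinv y + (counit G y : K) *: coinv x).
have perm (V : zmodType) (x y p q r s : V) :
    x + y - (p + q + (r + s)) = x - (p + r) + (y - (q + s)).
  by rewrite [p + q + _]addrACA opprD addrACA.
have perm3 (V : zmodType) (x x' y y' z z' : V) :
    x + x' + (y + y') + (z + z') = x + y + z + (x' + y' + z').
  by rewrite [x + x' + _]addrACA [LHS]addrACA.
have El y : linear (E^~ y).
  move=> k u w; rewrite /E mulrDl -sscalerAl !cl counitP !scalerDl scalerDr.
  by rewrite perm scalerBr scalerDr !scalerA [_ * k]mulrC.
have Er x : linear (E x).
  move=> k u w; rewrite /E mulrDr -sscalerAr !cl counitP !scalerDl scalerDr.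
  by rewrite perm scalerBr scalerDr !scalerA [_ * k]mulrC.
have E1 x y : ipow 1 (E x y).
  by apply: ipowB; [|apply: ipowD; apply: ipowZ]; apply: coinv_ipow.
pose N (s : tensor G G) (w : G) : G := tlift (fun x1 x2 => E x1 w * h0 x2) s.
have bN w : bilin (fun x1 x2 => E x1 w * h0 x2) by apply: superhom_mul_bilin.
have Nl w : linear (N^~ w) by apply/tlift_linear/bN.
have Nr s : linear (N s).
  move=> k u w; rewrite /N -tliftZ -tliftD; apply: eq_tlift => x1 x2.
  by rewrite Er mulrDl sscalerAl.
suff H x y : ipow 2 (conv (N (comul G x)) h0 y).
  apply: (conv_even_inj (El b)) => // x; move: b.
  apply: conv_even_inj => [k u w|y|y]; [exact: Nr | | exact: H].
  by apply: (@conv_ipow 1 0) => // w; apply: ipow_top.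
pose M (s t : tensor G G) : G := tlift (fun y1 y2 => N s y1 * h0 y2) t.
have bM s : bilin (fun y1 y2 => N s y1 * h0 y2) by apply: superhom_mul_bilin.
pose U (t : tensor G G) : G := tlift (fun y1 y2 => (counit G y1 : K) *: h0 y2) t.
have bU : bilin (fun y1 y2 : G => (counit G y1 : K) *: h0 y2) by apply: bilin_scale.
pose C (t : tensor G G) : G := tlift (fun y1 y2 => coinv y1 * h0 y2) t.
have bC : bilin (fun y1 y2 => coinv y1 * h0 y2) by apply: superhom_mul_bilin.
have Ul : linear U by apply: tlift_linear.
have Cl : linear C by apply: tlift_linear.
have Ml t : linear (M^~ t).
  move=> k u w; rewrite /M -tliftZ -tliftD; apply: eq_tlift => y1 y2.
  by rewrite Nl mulrDl sscalerAl.
have Mr s : linear (M s) by apply: tlift_linear.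
have Up y1 y2 : U (tpure y1 y2) = (counit G y1 : K) *: h0 y2 by apply: tlift_pure.
have Cp y1 y2 : C (tpure y1 y2) = coinv y1 * h0 y2 by apply: tlift_pure.
have Mp x1 x2 y1 y2 : M (tpure x1 x2) (tpure y1 y2) = E x1 y1 * h0 x2 * h0 y2.
  by rewrite /M tlift_pure // /N tlift_pure.
have Uc z : U (comul G z) = h0 z.
  rewrite -[in RHS](counitl z) (linear_tlift _ hl); last by apply: bilin_scale.
  by have [_ _ _ _ hZ] := linear_morphisms hl; apply: tlift_eq => u w; rewrite hZ.
have Cc z : ipow 2 (C (comul G z) - h1 z) by apply: conv_coinv_even.
(* [r] expands [C] on a product by writing [coinv(x_1 y_1)] as its Leibniz value plus [E]; the
   summand [M] carries [E] and is what must lie in I^2. *)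
pose r (s t : tensor G G) : G := U s * C t + C s * U t + M s t.
have br : bilin r.
  split=> u k s t; rewrite /r Cl Ul ?Ml ?Mr.
    by rewrite !mulrDl -!sscalerAl perm3 !scalerDr.
  by rewrite !mulrDr -!sscalerAr perm3 !scalerDr.
have Hr : ipow 2 (C (tmul (comul G x) (comul G y)) - r (comul G x) (comul G y)).
  apply: tlift_tmul => // [|u w|k i j l c d e f]; [exact: ipow0 | exact: ipowD |].
  rewrite /r !Up !Cp Mp.
  (* Cases on the parities of the right factors: two odd ones multiply into I^2, mixed ones have
     product killed by [h0], and for two even ones the difference is exactly zero. *)
  case: i l => [] [] /=; rewrite !(hpart_even_odd, hpart_idem);
    rewrite ?(mulr0, mul0r, scaler0, addr0, subr0).
  - rewrite hpart_mul_false !hpart_idem; apply/ipowZ/ipowMl/ipowD/ipowM1; try exact: ipow_hpart.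
    by rewrite hpart_even_odd mul0r; apply: ipow0.
  - rewrite hpart_mul_false hpart_even_odd hpart_odd_even mul0r mulr0 addr0 mulr0 scaler0.
    exact: ipow0.
  - rewrite hpart_mul_false hpart_even_odd hpart_odd_even mul0r mulr0 addr0 mulr0 scaler0.
    exact: ipow0.
  rewrite hpart_mul_false !hpart_idem !hpart_odd_even mul0r addr0 scale1r.
  rewrite -sscalerAl -sscalerAr.
  have -> : h0 d * (coinv (hpart j e) * h0 f) = coinv (hpart j e) * h0 d * h0 f.
    by rewrite mulrA evenC.
  set X := (X in ipow 2 X); suff -> : X = 0 by apply: ipow0.
  by rewrite {}/X /E !mulrBl !mulrDl -!sscalerAl mulrA [_ + (_ - _)]addrC subrK subrr.
rewrite -comulM in Hr.
have := ipowB Hr (Cc (x * y)); rewrite opprB addrC addrA subrK hpart_mul_true /r !Uc => h.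
have := ipowN (ipowD h (ipowD (ipowMl (h0 x) (Cc y)) (ipowMr (h0 y) (Cc x)))).
rewrite mulrBr mulrBl [X in _ + X]addrACA -opprD.
set p := (X in _ - (_ + M _ _) + (_ - X)); set q := (X in _ - (X + M _ _)).
suff -> : - (p - (q + M (comul G x) (comul G y)) + (q - p)) = M (comul G x) (comul G y) by [].
by rewrite opprD !opprB addrA subrK [q + _]addrC addrK.
Qed.

(** Right invariance of [der v] and the antipode give the value [v a] for the convolution of [der v]
    with the antipode. Modulo I this is also the derivative of [h1(a_1) S(a_2)]: the other Leibniz
    term has an odd factor, and [der v] sends even elements into I. *)
Lemma der_coinv v a : Lie1 v -> ipow 1 (der v (coinv a) - (v a : K) *: (1 : G)).
Proof.
move=> Lv; have [[vl _] v0] := Lv; have dl := der_linear vl.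
have al := @antip_lin K G.
have sl : linear (unit_mul G v) by apply: unit_mul_linear.
have e : conv (der v) (@antip K G) a = (v a : K) *: (1 : G).
  rewrite (eq_conv (der_conv v) (fun=> erefl)) convA //.
  by rewrite (eq_conv (fun=> erefl) (@conv_antipr K G)) conv_unitr.
rewrite -e /coinv /conv (linear_tlift _ dl); last first.
  by apply: superhom_mul_bilin => //; apply: hpart_linear.
rewrite -tliftB; apply: tlift_mem => [|u w|x y]; first exact: ipow0.
  exact: ipowD.
have [_ dD _ _ _] := linear_morphisms dl.
have -> : der v x = der v (h1 x) + der v (h0 x) by rewrite -dD addrC hpart_sum.
rewrite derM // [(der v (h1 x) + _) * _]mulrDl opprD addrACA subrr add0r sgn_odd ?hpart_idem //.
apply: ipowB; first exact/ipowMr/ipowN/ipow_hpart.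
exact/ipowMr/der_even.
Qed.

End Coinvariants.

(** * Descent along the powers of I *)

Section TriangularFamilies.
Variables (K : fieldType) (V : lmodType K).
Implicit Types (U S : set V) (ws : seq V).

Fixpoint adjoins U ws : set V := if ws is w :: ws' then adjoins (adjoin U w) ws' else U.

Lemma sub_adjoins U ws : U `<=` adjoins U ws.
Proof.
by elim: ws U => [|w ws IH] U u Uu //=; apply/IH/sub_adjoin.
Qed.

Lemma subspace_adjoins U ws : subspace U -> subspace (adjoins U ws).
Proof. by elim: ws U => [|w ws IH] U //= sU; apply/IH/subspace_adjoin. Qed.

Lemma adjoins_min U ws S : subspace S -> U `<=` S -> (forall w, w \in ws -> S w) ->
  adjoins U ws `<=` S.
Proof.
move=> sS; elim: ws U => [|w ws IH] U US wsS //=.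
apply: IH => [u [k Uk]|x xs]; last by apply: wsS; rewrite inE xs orbT.
rewrite -(subrK (k *: w) u); apply: (subspaceD sS); first exact: US.
by apply: subspaceZ => //; apply: wsS; rewrite mem_head.
Qed.

(** Each functional kills [U] and the earlier vectors and is 1 on its own vector; its values on
    later vectors are free, so the pairing matrix is unitriangular. *)
Fixpoint triangular U (l : seq (V * (V -> K^o))) : Prop :=
  if l is (w, f) :: l' then
    [/\ linear f, forall u, U u -> f u = 0, f w = 1 & triangular (adjoin U w) l']
  else True.

(** Vectors already in the span are dropped; each remaining one gets its functional from
    [functional_sep]. *)
Lemma ex_triangular U zs : subspace U -> adjoins U zs = setT ->
  exists2 l, triangular U l & adjoins U [seq p.1 | p <- l] = setT.
Proof.
elim: zs U => [|z zs IH] U sU /= full; first by exists [::].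
have [Uz|nUz] := pselect (U z).
  suff e : adjoin U z = U by apply: IH => //; rewrite -e.
  apply/seteqP; split; last exact: sub_adjoin.
  move=> u [k Uk]; rewrite -(subrK (k *: z) u).
  by apply: (subspaceD sU) => //; apply: subspaceZ.
have [l tl fl] := IH _ (subspace_adjoin z sU) full.
have [f [fl1 f0 f1]] := functional_sep sU nUz.
by exists ((z, f) :: l).
Qed.

End TriangularFamilies.

(** * Odd derivatives detect membership in the powers of I *)

Section Descent.
Variables (K : fieldType) (charK : 2%N \notin [pchar K]) (G : superHopf K).
Local Notation h0 := (@hpart K G false).
Local Notation h1 := (@hpart K G true).
Implicit Types (U : set G) (l : seq (G * (G -> K^o))) (v : G -> K^o).

(** The odd coordinate attached to a cotangent vector [w]; it represents [coinv w] modulo I^2. *)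
Definition ycoord (w : G) : G := h1 (coinv w).

Lemma ycoord_odd w : h1 (ycoord w) = ycoord w.
Proof. exact: hpart_idem. Qed.

Lemma coinv_ycoord w : ipow 2 (coinv w - ycoord w).
Proof.
rewrite -[X in X - _](hpart_sum (coinv w)) addrK.
exact/ipow1_even/coinv_ipow.
Qed.

Lemma der_ycoord v w : Lie1 v -> ipow 1 (der v (ycoord w) - (v w : K) *: (1 : G)).
Proof.
move=> Lv; have [[vl _] _] := Lv; have [_ _ _ dB _] := linear_morphisms (der_linear vl).
have -> : ycoord w = coinv w - (coinv w - ycoord w) by rewrite opprB addrC subrK.
rewrite dB addrAC; apply: ipowB; first exact: der_coinv.
by apply: der_ipow => //; apply: coinv_ycoord.
Qed.

(* The composite of the operators 1 - y_i d_i. *)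
Fixpoint proj l (a : G) : G :=
  if l is (w, v) :: l' then proj l' a - ycoord w * der v (proj l' a) else a.

(** Ensures that the functionals of a triangular family over [U] lie in Lie(G)_1, so that their
    [der] are odd derivations. *)
Definition forces_Lie1 U := forall v, linear v -> (forall u, U u -> v u = 0) -> Lie1 v.

Lemma forces_Lie1_adjoin U w : forces_Lie1 U -> forces_Lie1 (adjoin U w).
Proof. by move=> fU v vl v0; apply: fU => // u Uu; apply/v0/sub_adjoin. Qed.

Lemma projD U l a b : forces_Lie1 U -> triangular U l ->
  proj l (a + b) = proj l a + proj l b.
Proof.
elim: l U => [|[w v] l IH] U fU //= [vl v0 _ tl].
rewrite (IH _ (forces_Lie1_adjoin fU) tl).
by have [_ -> _ _ _] := linear_morphisms (der_linear vl); rewrite mulrDr opprD addrACA.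
Qed.

Lemma ipow_ycoordM w n b : ipow n b -> ipow n.+1 (ycoord w * b).
Proof. exact/ipowS/ycoord_odd. Qed.

Lemma proj_ipow U l n a : forces_Lie1 U -> triangular U l -> ipow n a -> ipow n (proj l a).
Proof.
move=> fU tl; elim: l U fU tl a => [|[w v] l IH] U fU //= [vl v0 _ tl] a an.
have h := IH _ (forces_Lie1_adjoin fU) tl _ an.
apply: ipowB => //; case: n h {an IH} => [|n] h; first exact: ipow_top.
by apply: ipow_ycoordM; apply: der_ipow => //; apply: fU.
Qed.

(** The functionals in [l] kill [w], so their derivations send [ycoord w] into I. The sign from
    moving a derivation past [ycoord w] cancels the one from exchanging two odd coordinates. *)
Lemma proj_ycoordM U l n w b : subspace U -> forces_Lie1 U -> triangular U l -> U w ->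
  ipow n b -> ipow n.+2 (proj l (ycoord w * b) - ycoord w * proj l b).
Proof.
move=> sU fU tl Uw bn; elim: l U sU fU tl Uw => [|[w' v] l IH] U sU fU /=.
  by move=> _ _; rewrite subrr; apply: ipow0.
move=> [vl v0 _ tl] Uw; have fU' : forces_Lie1 (adjoin U w') := forces_Lie1_adjoin fU.
have {}IH := IH _ (subspace_adjoin w' sU) fU' tl (sub_adjoin w' Uw).
have Lv := fU _ vl v0; have [_ dD _ dB _] := linear_morphisms (der_linear vl).
move: (proj_ipow fU' tl bn) IH; move: (proj l b) (proj l (ycoord w * b)) => c d cn IH.
set y := ycoord w in IH *; set y' := ycoord w'.
have swap : y * (y' * der v c) = - (y' * (y * der v c)).
  by rewrite !mulrA (oddC (ycoord_odd w) (ycoord_odd w')) mulNr.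
have -> : d - y' * der v d - y * (c - y' * der v c) =
    (d - y * c) - y' * der v (d - y * c) - y' * (der v y * c).
  rewrite dB derM // (sgn_odd (ycoord_odd w)) mulNr !mulrBr swap.
  rewrite opprK opprB -[_ - _ - y' * der v d]addrA -opprD -[RHS]addrA.
  rewrite [_ - _ - y' * (der v y * c)]addrAC subrr sub0r.
  by rewrite -!addrA -!opprD addrCA (addrC (y' * der v d)).
apply: ipowB; first apply: ipowB => //.
  by apply: ipow_ycoordM; apply: der_ipow.
apply: ipow_ycoordM; apply: ipowM1 => //.
by have := der_ycoord w Lv; rewrite (v0 _ Uw) scale0r subr0.
Qed.

(** If [w] is not the head, the inner operators already suffice. If it is, they commute with
    [y = ycoord w] modulo I^(n+2), and [(1 - y d)(y c) = - y (d(y) - 1) c] because [y^2 = 0]; here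
    [d(y) - 1] lies in I. *)
Lemma proj_kill U l n w b : subspace U -> forces_Lie1 U -> triangular U l ->
  w \in [seq p.1 | p <- l] -> ipow n b -> ipow n.+2 (proj l (ycoord w * b)).
Proof.
move=> sU fU tl wl bn; elim: l U sU fU tl wl => [//|[w' v] l IH] U sU fU /=.
move=> [vl v0 v1 tl]; have fU' : forces_Lie1 (adjoin U w') := forces_Lie1_adjoin fU.
have sU' := subspace_adjoin w' sU.
have Lv := fU _ vl v0; have [_ dD _ dB _] := linear_morphisms (der_linear vl).
rewrite inE => /orP[/eqP->|wl]; last first.
  have h := IH _ sU' fU' tl wl; apply: ipowB => //.
  by apply: ipow_ycoordM; apply: der_ipow.
have := proj_ycoordM sU' fU' tl (mem_adjoin w' sU) bn.
have := proj_ipow fU' tl bn; move: (proj l _) => c cn.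
set d := proj l _; set y := ycoord w' => h.
have -> : d - y * der v d = (d - y * c) - y * der v (d - y * c) - y * ((der v y - 1) * c).
  rewrite dB derM // (sgn_odd (ycoord_odd w')) mulNr mulrBl mul1r !mulrBr.
  rewrite [y * (y * _)]mulrA (odd_sq charK) ?ycoord_odd // mul0r subr0.
  by rewrite !opprB [RHS]addrAC [_ + (y * c - _)]addrA subrK addrA subrK.
apply: ipowB; first apply: ipowB => //.
  by apply: ipow_ycoordM; apply: der_ipow.
apply: ipow_ycoordM; apply: ipowM1 => //.
by have := der_ycoord w' Lv; rewrite v1 scale1r.
Qed.

Lemma proj_id U l n a : forces_Lie1 U -> triangular U l ->
  (forall v, Lie1 v -> ipow n (der v a)) -> ipow n.+1 (proj l a - a).
Proof.
move=> fU tl h; elim: l U fU tl => [|[w v] l IH] U fU /=.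
  by move=> _; rewrite subrr; apply: ipow0.
move=> [vl v0 _ tl]; have {}IH := IH _ (forces_Lie1_adjoin fU) tl.
have Lv := fU _ vl v0; rewrite addrAC; apply: ipowB => //; apply: ipow_ycoordM.
rewrite -(subrK a (proj l a)); have [_ -> _ _ _] := linear_morphisms (der_linear vl).
by apply: ipowD; [apply: der_ipow | apply: h].
Qed.

(* The quotient of K[G] by this subspace is the odd cotangent space at 1. *)
Definition Ucoinv : set G := [set u | ipow 2 (coinv u)].

Lemma subspace_Ucoinv : subspace Ucoinv.
Proof.
have cl := @coinv_linear K G; have [c0 _ _ _ _] := linear_morphisms cl.
split=> [|k u w]; first by rewrite /Ucoinv /= c0; apply: ipow0.
by rewrite /Ucoinv /= cl => hu hw; apply: ipowD => //; apply: ipowZ.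
Qed.

(** By [coinvM] the Leibniz defect of a product lies in [Ucoinv], so a functional vanishing there is
    a counit-derivation; it is odd because [Ucoinv] contains all even elements. *)
Lemma forces_Lie1_Ucoinv : forces_Lie1 Ucoinv.
Proof.
have [_ cD _ cB cZ] := linear_morphisms (@coinv_linear K G).
move=> v vl v0; have [_ vD _ vB vZ] := linear_morphisms vl; split; last first.
  by move=> a; apply/v0/coinv_even.
split=> // a b.
have := v0 (a * b - ((counit G a : K) *: b + (counit G b : K) *: a)).
rewrite vB vD !vZ /Ucoinv /= cB cD !cZ => /(_ (coinvM a b))/eqP.
by rewrite subr_eq0 => /eqP->; rewrite addrC mulrC.
Qed.

Lemma adjoins_Ucoinv zs : all_odd zs -> (forall x : G, mon zs 1 (h1 x)) ->
  adjoins Ucoinv zs = setT.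
Proof.
move=> zso zs_gen; apply/seteqP; split=> // a _.
have [_ cD _ cB cZ] := linear_morphisms (@coinv_linear K G).
rewrite -(hpart_sum a); apply: (subspaceD (subspace_adjoins _ subspace_Ucoinv)).
  exact/sub_adjoins/coinv_even.
suff gen U ws m : subspace U -> all_odd ws -> Ucoinv `<=` U -> mon ws 1 m -> adjoins U ws m.
  exact: gen subspace_Ucoinv zso _ (zs_gen a).
elim: ws U m => [|z ws IH] U m sU; first by move=> _ _ ->; case: sU.
move=> /all_odd_cons[zo wso] UU [b [c [_ hc ->]]] /=.
have sU' := subspace_adjoin z sU.
apply: (subspaceD (subspace_adjoins _ sU')); last first.
  by apply: IH => // u /UU Uu; apply: sub_adjoin.
(* Modulo [Ucoinv] the product [z b] is [z] times the counit of [b], since the counit of the odd [z]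
   is zero. *)
apply: sub_adjoins; exists (counit G b : K); apply: UU.
have := coinvM z b; rewrite -{2}zo counit_odd scale0r add0r.
by rewrite /Ucoinv /= cB cZ.
Qed.

(** The sum of I^(n+2) and the [ycoord w] multiples of I^n, the form in which [proj_kill] and
    [proj_ipow] apply. *)
Inductive yspan (ws : seq G) (n : nat) : G -> Prop :=
| yspan_ycoord w b : w \in ws -> ipow n b -> yspan ws n (ycoord w * b)
| yspan_ipow a : ipow n.+2 a -> yspan ws n a
| yspanD a b : yspan ws n a -> yspan ws n b -> yspan ws n (a + b).

Lemma yspanM ws n a b : yspan ws 0 a -> ipow n b -> yspan ws n (a * b).
Proof.
move=> h bn; elim: h => {a} [w c wws _|a a2|a c _ IHa _ IHc].
- by rewrite -mulrA; apply: yspan_ycoord => //; apply: ipowMl.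
- by apply: yspan_ipow; apply: ipowM2.
- by rewrite mulrDl; apply: yspanD.
Qed.

(** An odd [x] is a sum of [coinv(x_1) x_2], and each value of [coinv] is a combination of the
    [ycoord w] modulo I^2 because [ws] spans modulo [Ucoinv]. *)
Lemma ipow_yspan ws n a : adjoins Ucoinv ws = setT -> ipow n.+1 a -> yspan ws n a.
Proof.
move=> full; have cl := @coinv_linear K G.
have all_coinv u : yspan ws 0 (coinv u).
  suff h : adjoins Ucoinv ws `<=` [set u | yspan ws 0 (coinv u)] by apply: h; rewrite full.
  apply: adjoins_min => [|x|w wws].
  - split=> [|k x y] /=.
      by have [-> _ _ _ _] := linear_morphisms cl; apply/yspan_ipow/ipow0.
    rewrite cl => hx hy; apply: yspanD => //.
    by rewrite -[coinv x]mulr1 sscalerAr; apply: yspanM => //; apply: ipow_top.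
  - exact: yspan_ipow.
  - rewrite /= -(subrK (ycoord w) (coinv w)); apply: yspanD.
      exact/yspan_ipow/coinv_ycoord.
    by rewrite -[ycoord w]mulr1; apply: yspan_ycoord => //; apply: ipow_top.
move e : n.+1 => m h; elim: h e => {m a} [//|m|m a b _ IHa _ IHb|m x b xo hb _] e.
- exact/yspan_ipow/ipow0.
- by apply: yspanD; [apply: IHa | apply: IHb].
- case: e hb => <- hb; apply: yspanM => //; rewrite -xo -conv_coinv_id.
  apply: tlift_mem => [|u w|u w]; [exact/yspan_ipow/ipow0 | exact: yspanD|].
  by apply: yspanM => //; apply: ipow_top.
Qed.

(** The operator [proj] fixes [a] modulo I^(n+2) because the derivatives lie in I^(n+1), and it
    sends [a] into I^(n+2) because [a] lies in I^(n+1). *)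
Lemma der_descent n a : algebraic G -> ipow n.+1 a ->
  (forall v, Lie1 v -> ipow n.+1 (der v a)) -> ipow n.+2 a.
Proof.
move=> algG an dera; have [zs zso zs_gen] := odd_generators charK algG.
have sU := subspace_Ucoinv; have fU := forces_Lie1_Ucoinv.
have [l tl fl] := ex_triangular sU (adjoins_Ucoinv zso zs_gen).
rewrite -[a](subKr (proj l a)); apply: ipowB; last exact: proj_id tl dera.
have := ipow_yspan fl an; elim=> {a an dera} [w b wl bn|a an|a b _ IHa _ IHb].
- exact: (proj_kill sU fU tl wl bn).
- exact: proj_ipow tl an.
- by rewrite (projD _ _ fU tl); apply: ipowD.
Qed.

(* Lie(G)_1 and G_ev jointly separate the elements of K[G]. *)
Lemma der_stable_eq0 (N : set G) : algebraic G -> N `<=` ipow 1 ->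
  (forall v a, Lie1 v -> N a -> N (der v a)) -> forall a, N a -> a = 0.
Proof.
move=> algG N1 Nder a Na; have [zs zso zs_gen] := odd_generators charK algG.
apply: (ipow_nil charK zso zs_gen).
elim: (size zs) => [|n IH] in a Na *; first exact: N1.
apply: der_descent => // [|v Lv]; first exact: IH.
by apply/IH/Nder.
Qed.

End Descent.

Lemma hpart_odd_one (K : fieldType) (A : superAlg K) : hpart true (1 : A) = 0.
Proof. by rewrite -hpart_one hpart_proj. Qed.

(** * The center *)

Section TensorInclusions.
Variables (K : fieldType) (A B : superAlg K).

Lemma tmul_oner (a c : A) (d : B) : tmul (tpure a (1 : B)) (tpure c d) = tpure (a * c) d.
Proof.
rewrite tmulE /tmul_pure !big_bool /= !hpart_odd_one !hpart_one mul0r !tpure0r.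
by rewrite !scaler0 !add0r !expr0 !scale1r !mul1r -tpureDl -mulrDr addrC hpart_sum.
Qed.

Lemma tmul_onel (a : A) (b d : B) : tmul (tpure a b) (tpure (1 : A) d) = tpure a (b * d).
Proof.
rewrite tmulE /tmul_pure !big_bool /= hpart_odd_one hpart_one mulr0 !tpure0l.
by rewrite !scaler0 !add0r !expr0 !scale1r mulr1 -tpureDr -mulrDl addrC hpart_sum.
Qed.

Lemma tensor_inl_superhom : @is_superhom K A (tensorSuperAlg A B) (fun a => tpure a (1 : B)).
Proof.
split=> [k a c|//|a c|i a]; first by rewrite tpureDl tpureZl.
  by symmetry; apply: tmul_oner.
change (tpure (hpart i a) (1 : B) = thpart i (tpure a (1 : B))).
rewrite /thpart (tlift_pure _ _ (thpart_bilin _ _ i)) big_bool.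
by case: i; rewrite /= hpart_odd_one hpart_one tpure0r ?addr0 ?add0r.
Qed.

Lemma tensor_inr_superhom : @is_superhom K B (tensorSuperAlg A B) (fun b => tpure (1 : A) b).
Proof.
split=> [k a c|//|a c|i b]; first by rewrite tpureDr tpureZr.
  by symmetry; apply: tmul_onel.
change (tpure (1 : A) (hpart i b) = thpart i (tpure (1 : A) b)).
rewrite /thpart (tlift_pure _ _ (thpart_bilin _ _ i)) big_bool /= hpart_odd_one hpart_one.
by rewrite tpure0l add0r.
Qed.

Definition tensor_inl : superhom A (tensorSuperAlg A B) := SuperHom tensor_inl_superhom.
Definition tensor_inr : superhom B (tensorSuperAlg A B) := SuperHom tensor_inr_superhom.

Lemma tensor_inl_inr a b : tensor_inl a * tensor_inr b = tpure a b.
Proof.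
by change (tmul (tpure a (1 : B)) (tpure (1 : A) b) = tpure a b); rewrite tmul_oner mulr1.
Qed.

Lemma tensor_inr_inl a b : tensor_inr b * tensor_inl a =
  \sum_(i : bool) \sum_(j : bool) (-1) ^+ (i && j) *: tpure (hpart j a) (hpart i b).
Proof.
change (tmul (tpure (1 : A) b) (tpure a (1 : B)) =
  \sum_(i : bool) \sum_(j : bool) (-1) ^+ (i && j) *: tpure (hpart j a) (hpart i b)).
rewrite tmulE /tmul_pure; apply: eq_bigr => i _; apply: eq_bigr => j _.
by rewrite mul1r mulr1.
Qed.

Lemma tmul_even a b c d : purely_even A ->
  tmul (tpure a b) (tpure c d) = tpure (a * c) (b * d) :> tensor A B.
Proof.
move=> evA; have cE : hpart false c = c by rewrite -[RHS]hpart_sum evA addr0.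
rewrite tmulE /tmul_pure !big_bool /= evA cE mulr0 !tpure0l !scaler0 !add0r.
by rewrite !expr0 !scale1r -tpureDr -mulrDl addrC hpart_sum.
Qed.

End TensorInclusions.

Lemma superhom_ker_ideal (K : fieldType) (A B : superAlg K) (f : superhom A B) :
  is_ideal [set a | f a = 0].
Proof.
have [fl _ fM _] := superhomP f; have [f0 fD _ _ _] := linear_morphisms fl.
split=> //= [a b|a b|a b]; first by rewrite fD => -> ->; rewrite addr0.
  by rewrite fM => ->; rewrite mulr0.
by rewrite fM => ->; rewrite mul0r.
Qed.

Lemma ideal_gen_min (K : fieldType) (A : superAlg K) (P J : set A) :
  is_ideal J -> P `<=` J -> ideal_gen P `<=` J.
Proof. by move=> Jid PJ a; apply. Qed.

Section BilinearMaps.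
Variables (K : fieldType) (A B V : lmodType K).

Lemma bilinB (f g : A -> B -> V) :
  bilin f -> bilin g -> bilin (fun x y => f x y - g x y).
Proof.
move=> [fl fr] [gl gr]; split=> [y|x] k u v /=.
  by rewrite fl gl opprD addrACA scalerBr.
by rewrite fr gr opprD addrACA scalerBr.
Qed.

Lemma bilin_sum (I : finType) (f : I -> A -> B -> V) :
  (forall i, bilin (f i)) -> bilin (fun x y => \sum_i f i x y).
Proof.
move=> bf; split=> [y|x] k u v /=; rewrite scaler_sumr -big_split /=;
  by apply: eq_bigr => i _; have [fl fr] := bf i; rewrite ?fl ?fr.
Qed.

Lemma bilinZ (c : K) (f : A -> B -> V) : bilin f -> bilin (fun x y => c *: f x y).
Proof.
move=> [fl fr]; split=> [y|x] k u v /=.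
  by rewrite fl scalerDr !scalerA mulrC.
by rewrite fr scalerDr !scalerA mulrC.
Qed.

End BilinearMaps.

(** * Central points over purely even algebras *)

Section Center.
Variables (K : fieldType) (G : superHopf K).

Lemma even_point_odd (R : superComAlg K) (g : superhom G R) a :
  purely_even R -> g (hpart true a) = 0.
Proof. by move=> evR; case: (superhomP g) => _ _ _ ->; apply: evR. Qed.

Lemma even_Gev (R : superComAlg K) (g : superhom G R) : purely_even R -> Gev G R g.
Proof.
move=> evR; apply: ideal_gen_min; first exact: superhom_ker_ideal.
by move=> a /= <-; apply: even_point_odd.
Qed.

Section Point.
Variables (R : superComAlg K) (evenR : purely_even R) (g : superhom G R).

(* g commutes with the universal point of G, as elements of G(R (x) K[G]); no
   sign appears because g kills K[G]_1 when R is purely even. *)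
Definition universally_central : Prop := forall a,
  tlift (fun x y => tpure (g x) y : tensor R G) (comul G a) =
  tlift (fun x y => tpure (g y) x : tensor R G) (comul G a).

Let gl : linear g. Proof. by case: (superhomP g). Qed.

Lemma evenR_comm (S : superComAlg K) (f : superhom R S) r s : f r * s = s * f r.
Proof.
have -> : r = hpart false r by rewrite -[LHS]hpart_sum evenR addr0.
by have [_ _ _ ->] := superhomP f; apply: evenC.
Qed.

Lemma evenR_mulC (r s : R) : r * s = s * r.
Proof.
have -> : r = hpart false r by rewrite -[LHS]hpart_sum evenR addr0.
exact: evenC.
Qed.

Lemma bilin_pointl : bilin (fun x y : G => tpure (g x) y : tensor R G).
Proof.
split=> [y|x] k u v /=; first by rewrite gl tpureDl tpureZl.
by rewrite tpureDr tpureZr.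
Qed.

Lemma bilin_pointr : bilin (fun x y : G => tpure (g y) x : tensor R G).
Proof. exact: bilin_flip bilin_pointl. Qed.

Lemma universally_centralE (V : lmodType K) (f : R -> G -> V) a : bilin f ->
  universally_central ->
  tlift (fun x y => f (g x) y) (comul G a) = tlift (fun x y => f (g y) x) (comul G a).
Proof.
move=> bf /(_ a)/(congr1 (tlift f)); have fl := tlift_linear bf.
rewrite (tlift_comp _ fl bilin_pointl) (tlift_comp _ fl bilin_pointr).
have p x y : tlift f (tpure x y) = f x y by apply: tlift_pure.
by rewrite (eq_tlift _ (fun x y => p (g x) y)) (eq_tlift _ (fun x y => p (g y) x)).
Qed.

(** Any point [h] is a specialization of the universal one; the values of [g] commute with it
    because they are even. *)
Lemma universally_central_center : universally_central -> center G R g.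
Proof.
move=> cg S f h; apply: superhom_eq => a; rewrite !point_mulE.
have [fl _ _ _] := superhomP f; have [hl _ _ _] := superhomP h.
have bf : bilin (fun (r : R) (x : G) => f r * h x) by apply: superhom_mul_bilin.
rewrite /conv (universally_centralE a bf cg); apply: eq_tlift => x y.
exact: evenR_comm.
Qed.

Lemma Lie1_ext_linear (u : G -> R) : Lie1_ext u -> linear u.
Proof.
move=> [n [v [r [Lv ->]]]] k a b; rewrite scaler_sumr -big_split /=.
by apply: eq_bigr => i _; have [[vl _] _] := Lv i; rewrite vl scalerDl scalerA.
Qed.

Lemma point_inv_linear : linear (point_inv g).
Proof. by move=> k a b; rewrite /point_inv antip_linear gl. Qed.

(** Convolution with [g] on the left, or with its inverse, turns one equation into the other. *)
Lemma rho_fixed (u : G -> R) : linear u -> rho g u = u <-> conv g u =1 conv u g.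
Proof.
move=> ul; have il := point_inv_linear; split=> [e a|e].
  have e1 : conv u g =1 conv (conv g (conv (point_inv g) u)) g.
    apply: eq_conv => // b; rewrite -convA //.
    by rewrite (eq_conv (point_mulVr g) (fun=> erefl)) conv_unitl.
  rewrite e1 convA //; last exact: conv_linear.
  by apply: eq_conv => // b; rewrite -/(rho g u) e.
apply/funext => a; rewrite /rho convA //.
rewrite -(eq_conv (fun=> erefl) e) -convA //.
by rewrite (eq_conv (point_mulVl g) (fun=> erefl)) conv_unitl.
Qed.

Lemma universally_central_ker_rho : universally_central -> ker_rho G R g.
Proof.
move=> cg; split; first exact: even_Gev.
move=> u /Lie1_ext_linear ul; apply/rho_fixed => // a.
have bf : bilin (fun (r : R) (x : G) => r * u x) by apply: superhom_mul_bilin.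
rewrite /conv (universally_centralE a bf cg); apply: eq_tlift => x y.
exact: evenR_mulC.
Qed.

(** Slicing the commutator with the universal point by a functional [p] on K[G] gives the value of
    [g] at an element that depends only on [p] and [a]. All central points kill that element, so it
    lies in the ideal of the center. *)
Lemma center_ideal_universally_central :
  (forall a, ideal_of (center G) a -> g a = 0) -> universally_central.
Proof.
move=> g0 a; set L := (X in X = _); set L' := (X in _ = X).
apply/eqP; rewrite -subr_eq0; apply/eqP; apply: tensor_sepr => p pl.
pose Phi (A : superAlg K) (t : tensor A G) : A := tlift (fun (r : A) x => p x *: r) t.
have bp (A : superAlg K) : bilin (fun (r : A) x => p x *: r).
  by apply: bilin_flip; apply: bilin_scale.
have Phil (A : superAlg K) : linear (Phi A) by apply/tlift_linear/bp.
have Phip (A : superAlg K) (r : A) x : Phi A (tpure r x) = p x *: r.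
  exact: (tlift_pure r x (bp A)).
have [_ _ _ PhiB _] := linear_morphisms (Phil R).
change (Phi R (L - L') = 0).
rewrite PhiB {}/L {}/L' (tlift_comp _ (Phil R) bilin_pointl) (tlift_comp _ (Phil R) bilin_pointr).
rewrite (eq_tlift _ (fun x y => Phip R (g x) y)) (eq_tlift _ (fun x y => Phip R (g y) x)).
rewrite -tliftB.
(* The double sum is the sign rule for reversing a product; it is kept because central points over
   arbitrary superalgebras must kill this element. *)
pose d (x y : G) : G := p y *: x -
  \sum_(i : bool) \sum_(j : bool) (-1) ^+ (i && j) *: (p (hpart i x) *: hpart j y).
have bd : bilin d.
  apply: bilinB; first by apply: bilin_flip; apply: bilin_scale.
  apply: bilin_sum => i; apply: bilin_sum => j; apply: bilinZ; apply: bilin_scale.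
    by move=> k u v; rewrite hpart_linear pl.
  exact: hpart_linear.
have dJ : ideal_of (center G) (tlift d (comul G a)).
  move=> R' g' cg'; have [g'l _ _ g'h] := superhomP g'.
  have [_ _ _ g'B g'Z] := linear_morphisms g'l.
  set f1 := tensor_inl R' G; set f2 := tensor_inr R' G.
  have [f1l _ _ _] := superhomP f1; have [f2l _ _ _] := superhomP f2.
  have f1gl : linear (f1 \o g') by move=> k u v /=; rewrite g'l; apply: f1l.
  have Phl : linear (Phi R' : tensorSuperAlg R' G -> R') by apply: Phil.
  have := cg' (tensorSuperComAlg R' G) f1 f2.
  move/(congr1 (fun f : superhom G (tensorSuperComAlg R' G) => Phi R' (f a))) => e.
  have {}e : Phi R' (tlift (fun x y => (f1 \o g') x * f2 y) (comul G a)) =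
    Phi R' (tlift (fun x y => f2 x * (f1 \o g') y) (comul G a)) by exact: e.
  have e1 x y : Phi R' ((f1 \o g') x * f2 y) = p y *: g' x.
    by rewrite /= tensor_inl_inr Phip.
  have e2 x y : Phi R' (f2 x * (f1 \o g') y) =
      g' (\sum_(i : bool) \sum_(j : bool) (-1) ^+ (i && j) *: (p (hpart i x) *: hpart j y)).
    rewrite /= tensor_inr_inl (linear_sum_seq _ _ Phl) (linear_sum_seq _ _ g'l).
    apply: eq_bigr => i _; rewrite (linear_sum_seq _ _ Phl) (linear_sum_seq _ _ g'l).
    apply: eq_bigr => j _; have [_ _ _ _ PZ] := linear_morphisms Phl.
    by rewrite PZ !g'Z g'h Phip.
  have b12 := superhom_mul_bilin f1gl f2l; have b21 := superhom_mul_bilin f2l f1gl.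
  rewrite (tlift_comp _ Phl b12) (tlift_comp _ Phl b21) in e.
  rewrite (eq_tlift _ e1) (eq_tlift _ e2) in e.
  rewrite linear_tlift //; have -> : tlift (fun x y => g' (d x y)) (comul G a) =
      tlift (fun x y => p y *: g' x) (comul G a) - tlift (fun x y => g' (\sum_(i : bool)
        \sum_(j : bool) (-1) ^+ (i && j) *: (p (hpart i x) *: hpart j y))) (comul G a).
    by rewrite -tliftB; apply: eq_tlift => x y; rewrite /d g'B g'Z.
  by apply/eqP; rewrite subr_eq0; apply/eqP; apply: e.
have [_ gD _ gB gZ] := linear_morphisms gl.
rewrite -[RHS](g0 _ dJ) linear_tlift //; apply: eq_tlift => x y.
(* Over purely even [R] only the terms with even [y] part survive; they carry no sign, and the two
   parts of [x] recombine. *)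
rewrite /d gB gZ; congr (_ - _); rewrite !big_bool /= !gD !gZ !even_point_odd //.
rewrite !scaler0 !add0r !expr0 !scale1r -scalerDl.
have [_ pD _ _ _] := linear_morphisms pl; rewrite -pD addrC hpart_sum.
by rewrite -[in LHS](hpart_sum y) gD even_point_odd // addr0.
Qed.

Lemma ipow_commutator (A : superComAlg K) (x y : A) : ipow 1 (x * y - y * x).
Proof.
rewrite -(hpart_sum x) mulrDl mulrDr evenC opprD addrACA subrr add0r.
by apply: ipowB; [apply: ipowMr | apply: ipowMl]; apply: ipow_hpart.
Qed.

Definition slice (f : R -> K^o) (t : tensor R G) : G := tlift (fun r x => f r *: x) t.

Lemma slice_bilin (f : R -> K^o) : linear f -> bilin (fun r (x : G) => f r *: x).
Proof. by move=> fl; apply: bilin_scale. Qed.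

Lemma slice_linear f : linear f -> linear (slice f).
Proof. by move=> fl; apply/tlift_linear/slice_bilin. Qed.

Lemma slice_pure f r x : linear f -> slice f (tpure r x) = f r *: x.
Proof. by move=> fl; apply: (tlift_pure r x (slice_bilin fl)). Qed.

(* The ideal R (x) I of R (x) K[G], cut out by the functionals on R. *)
Definition odd_ideal : set (tensorSuperAlg R G) :=
  [set t | forall f : R -> K^o, linear f -> ipow 1 (slice f t)].

Lemma sliceMl (f : R -> K^o) (r : R) (x : G) t : linear f ->
  slice f (tmul (tpure r x) t) = x * (slice (fun s : R => f (r * s)) t : G).
Proof.
move=> fl; have frl : linear (fun s : R => f (r * s)).
  by move=> k u v; rewrite mulrDr -sscalerAr fl.
have ml := (tmul_bilin R G).2 (tpure r x); have sl := slice_linear fl.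
move: t; apply: linear_tensor_ext => [k u v|k u v|s y].
- by rewrite ml sl.
- by rewrite (slice_linear frl) mulrDr -sscalerAr.
- by rewrite tmul_even // !slice_pure // -sscalerAr.
Qed.

Lemma sliceMr (f : R -> K^o) (r : R) (x : G) t : linear f ->
  slice f (tmul t (tpure r x)) = (slice (fun s : R => f (s * r)) t : G) * x.
Proof.
move=> fl; have frl : linear (fun s : R => f (s * r)).
  by move=> k u v; rewrite mulrDl -sscalerAl fl.
have ml := (tmul_bilin R G).1 (tpure r x); have sl := slice_linear fl.
move: t; apply: linear_tensor_ext => [k u v|k u v|s y].
- by rewrite ml sl.
- by rewrite (slice_linear frl) mulrDl -sscalerAl.
- by rewrite tmul_even // !slice_pure // -sscalerAl.
Qed.

Lemma odd_ideal_ideal : is_ideal odd_ideal.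
Proof.
split=> [f fl|s t hs ht f fl|s t ht f fl|s t ht f fl].
- by have [-> _ _ _ _] := linear_morphisms (slice_linear fl); apply: ipow0.
- have [_ sD _ _ _] := linear_morphisms (slice_linear fl).
  change (ipow 1 (slice f ((s : tensor R G) + (t : tensor R G)))); rewrite sD.
  by apply: ipowD; [apply: hs | apply: ht].
- change (ipow 1 (slice f (tmul s t))); have [s0 sD _ _ _] := linear_morphisms (slice_linear fl).
  move: s; apply: tensor_ind => [|r x|u v hu hv].
  + by rewrite tmul0l s0; apply: ipow0.
  + rewrite sliceMl //; apply/ipowMl/ht.
    by move=> k u v; rewrite mulrDr -sscalerAr fl.
  + by rewrite tmulDl sD; apply: ipowD.
- change (ipow 1 (slice f (tmul s t))); have [s0 sD _ _ _] := linear_morphisms (slice_linear fl).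
  move: t; apply: tensor_ind => [|r x|u v hu hv].
  + by rewrite tmul0r s0; apply: ipow0.
  + rewrite sliceMr //; apply/ipowMr/ht.
    by move=> k u v; rewrite mulrDl -sscalerAl fl.
  + by rewrite tmulDr sD; apply: ipowD.
Qed.

Lemma odd_ideal_odd : @odd_part K (tensorSuperAlg R G) `<=` odd_ideal.
Proof.
move=> t /= <- f fl; change (ipow 1 (slice f (thpart true t))).
have [s0 sD _ _ _] := linear_morphisms (slice_linear fl); have [f0 _ _ _ _] := linear_morphisms fl.
move: t; apply: tensor_homog_ind => [|i j r x|u v hu hv].
- by rewrite thpart0 s0; apply: ipow0.
- rewrite thpart_homog; case: i j => [] [] /=; rewrite ?s0; try exact: ipow0.
    by rewrite slice_pure // evenR f0 scale0r; apply: ipow0.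
  by rewrite slice_pure //; apply/ipowZ/ipow_hpart.
- by rewrite thpartD sD; apply: ipowD.
Qed.

Lemma odd_ideal_comm (s t : tensorSuperAlg R G) : odd_ideal (s * t - t * s).
Proof.
move=> f fl; change (ipow 1 (slice f (tmul s t - tmul t s))).
have [s0 sD _ sB _] := linear_morphisms (slice_linear fl).
move: s t; apply: tensor_ind => [t|r x t|u v hu hv t].
- by rewrite tmul0l tmul0r subrr s0; apply: ipow0.
- move: t; apply: tensor_ind => [|s y|u v hu hv].
  + by rewrite tmul0l tmul0r subrr s0; apply: ipow0.
  + rewrite !tmul_even // sB !slice_pure // [s * r]evenR_mulC -scalerBr.
    exact/ipowZ/ipow_commutator.
  + by rewrite tmulDl tmulDr opprD addrACA sD; apply: ipowD.
- by rewrite tmulDl tmulDr opprD addrACA sD; apply: ipowD.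
Qed.

(** Dividing R (x) K[G] by R (x) I gives a purely even algebra, over which the universal point
    becomes a point of Gev. There [g] commutes with it, so the commutator lies in [odd_ideal]. *)
Lemma center_Gev_slice f a : center_Gev G R g -> linear f ->
  ipow 1 (slice f (tlift (fun x y => tpure (g x) y : tensor R G) (comul G a)
                   - tlift (fun x y => tpure (g y) x : tensor R G) (comul G a))).
Proof.
move=> [_ cg] fl.
pose S := evenQuotient odd_ideal_ideal odd_ideal_comm.
pose pi : superhom (tensorSuperAlg R G) S :=
  evenQuotient_proj odd_ideal_ideal odd_ideal_odd odd_ideal_comm.
have evS : purely_even S by [].
pose i1 := tensor_inl R G; pose i2 := tensor_inr R G.
have [il _ _ _] := superhomP i1; have [i2l _ _ _] := superhomP i2.
have [pl _ pM _] := superhomP pi.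
have := cg S (superhom_comp pi i1) (superhom_comp pi i2) evS (even_Gev _ evS).
move/(congr1 (fun h : superhom G S => h a)) => e.
have {}e : tlift (fun x y => pi (i1 (g x)) * pi (i2 y)) (comul G a) =
    tlift (fun x y => pi (i2 x) * pi (i1 (g y))) (comul G a) by exact: e.
have e1 x y : pi (i1 (g x)) * pi (i2 y) = pi (tpure (g x) y).
  by rewrite -pM tensor_inl_inr.
have e2 x y : pi (i2 x) * pi (i1 (g y)) = pi (tpure (g y) x).
  rewrite -pM tensor_inr_inl !big_bool /= evenR !tpure0l !scaler0 !add0r !expr0 !scale1r.
  rewrite -tpureDr addrC hpart_sum; congr (pi (tpure _ _)).
  by rewrite -[RHS]hpart_sum evenR addr0.
rewrite (eq_tlift _ e1) (eq_tlift _ e2) in e.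
have pl' : linear (pi : tensor R G -> S) by exact: pl.
rewrite -(tlift_comp _ pl' bilin_pointl) -(tlift_comp _ pl' bilin_pointr) in e.
set t := _ - _; suff : odd_ideal t by apply.
suff : pi t = 0 by apply: evenQuotient_proj_eq0.
have [_ _ _ pB _] := linear_morphisms pl'.
by apply: (etrans (pB _ _)); apply/eqP; rewrite subr_eq0; apply/eqP.
Qed.

Lemma center_Gev_ker_rho : 2%N \notin [pchar K] -> algebraic G ->
  center_Gev G R g -> ker_rho G R g -> universally_central.
Proof.
move=> charK algG cg [_ rg] a; apply/eqP; rewrite -subr_eq0; apply/eqP.
apply: tensor_sepl => f fl.
pose y b := slice f (tlift (fun x y => tpure (g x) y : tensor R G) (comul G b)
                   - tlift (fun x y => tpure (g y) x : tensor R G) (comul G b)).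
(* The values of [q] are scalars and commute with all of K[G]; [y] becomes the convolution
   commutator of [q] and [id]. *)
rewrite -[LHS]/(y a); pose q := unit_mul G (f \o g).
have ql : linear q by apply: unit_mul_linear => k u v /=; rewrite gl fl.
have idl : linear (@id G) by [].
have qC x z : q x * z = z * q x by rewrite /q /unit_mul -sscalerAl -sscalerAr mul1r mulr1.
have yE b : y b = conv q id b - conv id q b.
  have sl := slice_linear fl; have [_ _ _ sB _] := linear_morphisms sl.
  rewrite /y sB (tlift_comp _ sl bilin_pointl) (tlift_comp _ sl bilin_pointr).
  congr (_ - _); apply: eq_tlift => u w; rewrite slice_pure //.
    by rewrite /q /unit_mul -sscalerAl mul1r.
  by rewrite -qC /q /unit_mul -sscalerAl mul1r.
have yl : linear y.
  by move=> k u w; rewrite !yE !conv_linear // scalerBr opprD addrACA.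
suff h : range y `<=` [set 0] by apply: (h (y a)); exists a.
move=> _ [b _ <-] /=; apply: (der_stable_eq0 charK (N := range y)) => //.
  by move=> _ [c _ <-]; apply: center_Gev_slice.
(* [y] commutes with [der v], so its range is stable. Invariance of [v] under [g] makes [q] commute
   with [w] under convolution, and associativity does the rest. *)
move=> v _ Lv [c _ <-]; exists (der v c) => //.
have [[vl _] _] := Lv; pose w := unit_mul G v.
have wl : linear w by apply: unit_mul_linear.
have uext : Lie1_ext (unit_mul R v).
  exists 1%N, (fun=> v), (fun=> 1); split=> //.
  by apply/funext => x; rewrite big_ord1.
have gu := (rho_fixed (Lie1_ext_linear uext)).1 (rg _ uext).
have qw b' : conv q w b' = conv w q b'.
  have bl : bilin (fun x z : G => g x * unit_mul R v z).
    by apply: superhom_mul_bilin => //; apply: unit_mul_linear.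
  have br : bilin (fun x z : G => unit_mul R v x * g z).
    by apply: superhom_mul_bilin => //; apply: unit_mul_linear.
  have [_ _ _ _ fZ] := linear_morphisms fl.
  have Fl : linear (fun c : K^o => (c : K) *: (1 : G)).
    by move=> k x z; rewrite scalerDl -scalerA.
  have e1 x z : q x * w z = (f (g x * unit_mul R v z) : K) *: (1 : G).
    rewrite /q /w /unit_mul -sscalerAl mul1r -sscalerAr mulr1 fZ scalerA.
    by rewrite [LHS](_ : _ = ((v z : K) * (f (g x) : K)) *: (1 : G)) // mulrC.
  have e2 x z : w x * q z = (f (unit_mul R v x * g z) : K) *: (1 : G).
    by rewrite /q /w /unit_mul -!sscalerAl !mul1r fZ scalerA.
  have := congr1 (fun r : R => (f r : K) *: (1 : G)) (gu b').
  rewrite /conv (tlift_comp _ fl bl) (tlift_comp _ fl br).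
  rewrite (tlift_comp _ Fl (bilin_comp fl bl)) (tlift_comp _ Fl (bilin_comp fl br)).
  by rewrite (eq_tlift _ e1) (eq_tlift _ e2).
have dl := der_linear vl; have [_ _ _ dB dZ] := linear_morphisms dl.
have yder : y (der v c) = conv w y c.
  have [_ _ _ _ yZ] := linear_morphisms yl.
  rewrite /der linear_tlift //; last exact: der_bilin.
  by apply: eq_tlift => x z; rewrite yZ /w /unit_mul -sscalerAl mul1r.
have derl : der v (conv q id c) = conv w (conv q id) c.
  rewrite /conv linear_tlift //; last exact: superhom_mul_bilin.
  have -> : tlift (fun x z => der v (q x * id z)) (comul G c) = conv q (conv w id) c.
    apply: eq_tlift => x z; rewrite -(der_conv v z) /q /unit_mul -!sscalerAl !mul1r.
    exact: dZ.
  rewrite -convA //; rewrite -[RHS]/(conv w (conv q id) c) -[RHS]convA //.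
  exact: eq_conv qw _ _.
have derr : der v (conv id q c) = conv w (conv id q) c.
  rewrite /conv linear_tlift //; last exact: superhom_mul_bilin.
  rewrite -[RHS]/(conv w (conv id q) c) -convA //.
  apply: eq_tlift => x z; rewrite -(der_conv v x) -!qC /q /unit_mul -!sscalerAl !mul1r.
  exact: dZ.
rewrite yder yE dB derl derr /conv -tliftB.
by apply: eq_tlift => x z; rewrite yE mulrBr.
Qed.

End Point.
End Center.

Theorem proposition7p1 (K : fieldType) (charK : 2%N \notin [pchar K])
  (G : superHopf K) (algG : algebraic G) (R : superComAlg K) (evenR : purely_even R) :
  ev (center G) R = center_Gev G R `&` ker_rho G R.
Proof.
apply/seteqP; split=> g.
  move=> gev; have cg : universally_central g.
    apply: center_ideal_universally_central => // a aJ; apply: gev.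
    by move=> J Jid sub; apply: sub; left.
  split; last exact: universally_central_ker_rho.
  split; first exact: even_Gev.
  by move=> S f h _ _; apply: universally_central_center.
move=> [cg rg]; apply: ideal_gen_min; first exact: superhom_ker_ideal.
move=> a [aJ|<-] /=; last exact: even_point_odd.
(* [a] vanishes at every central point, so it is enough that [g] is central. *)
apply: aJ; apply: universally_central_center => //.
exact: center_Gev_ker_rho.
Qed.
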